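(* Let $\mathbf{H}$ be a pseudovariety all of whose members are finite solvable groups. Then $$C^\infty_{\mathbf{H}}(N) \in \mathcal{O}(\log N) \quad\text{and}\quad C^4_{\mathbf{H}}(N) \in \mathcal{O}(\log^3 N).$$
   Context: A pseudovariety is a class of finite semigroups closed under finite direct products, subsemigroups, and homomorphic images. Straight-line programs. Let $S$ be a finite semigroup and $\Sigma \subseteq S$. A straight-line program over $\Sigma$ is a finite sequence of instructions executed in order and operating on registers $r_1, r_2, \dots$, each able to store one element of $S$. Each instruction is either $r_k \gets s$ for some $s \in \Sigma$, or $r_k \gets r_i \cdot r_j$, where $i,j,k$ need not be distinct and $r_i, r_j$ must have been assigned by previous instructions (in particular, no inversion instruction is available). Its length is the number of its instructions, its width is the number of registers it operates on. It computes $t \in S$ if upon completion some register contains $t$. For $2 \leq w \leq \infty$, $c^w_S(t;\Sigma)$ denotes the minimal length of a straight-line program over $\Sigma$ of width at most $w$ computing $t$. Put $C^w_S = \max\{c^w_S(t;\Sigma) : \Sigma \subseteq S,\ t \in \langle \Sigma \rangle\}$, where $\langle\Sigma\rangle$ is the subsemigroup generated by $\Sigma$, and $C^w_{\mathbf{H}}(N) = \max\{C^w_S : S \in \mathbf{H}, |S| \leq N\}$. Asymptotics are for $N \to \infty$. *)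

(* Defs.v *)
From HB Require Import structures.
From mathcomp Require Import all_boot all_order all_algebra all_fingroup.
From mathcomp Require Import all_solvable.
From mathcomp Require Import all_classical all_reals all_analysis.

Set Implicit Arguments.
Unset Strict Implicit.
Unset Printing Implicit Defensive.

(* The library has no structure joining finType and semigroupType, and one can
   no longer be inserted below finGroupType; hence this package. *)
Record finSemigroup := FinSemigroup {
  fsg_finType : finType;
  fsg_mul : fsg_finType -> fsg_finType -> fsg_finType;
  fsg_mulA : associative fsg_mul }.

Definition fsg_sort (S : finSemigroup) : Type := fsg_finType S.
Coercion fsg_sort : finSemigroup >-> Sortclass.

HB.instance Definition _ (S : finSemigroup) :=
  Finite.copy (fsg_sort S) (fsg_finType S).
HB.instance Definition _ (S : finSemigroup) :=
  hasMul.Build (fsg_sort S) (@fsg_mul S).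
HB.instance Definition _ (S : finSemigroup) :=
  Magma_isSemigroup.Build (fsg_sort S) (@fsg_mulA S).

Section DirectProduct.
Variables (I : finType) (S : I -> finSemigroup).

Definition prod_mul (x y : {dffun forall i, S i}) : {dffun forall i, S i} :=
  [ffun i => (x i * y i)%g].

Lemma prod_mulA : associative prod_mul.
Proof. by move=> x y z; apply/ffunP => i; rewrite !ffunE mulgA. Qed.

Definition direct_product : finSemigroup := FinSemigroup prod_mulA.

End DirectProduct.

(* A class of finite semigroups is a predicate on finSemigroup.  Semigroups are
   nonempty by convention.  Closure under subsemigroups is closure under
   injective morphisms into a member, so that classes are automatically closed
   under isomorphism; the empty product (the one-element semigroup) is among
   the finite direct products. *)
Record pseudovariety (H : finSemigroup -> Prop) : Prop := {
  pv_nonempty : forall S, H S -> 0 < #|{: S}|;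
  pv_prod : forall (I : finType) (S : I -> finSemigroup),
    (forall i, H (S i)) -> H (direct_product S);
  pv_sub : forall (S T : finSemigroup) (f : {multiplicative T -> S}),
    H S -> 0 < #|{: T}| -> injective f -> H T;
  pv_quo : forall (S T : finSemigroup) (f : {multiplicative S -> T}),
    H S -> (forall y, exists x, f x = y) -> H T }.

Definition is_solvable_group (S : finSemigroup) : Prop :=
  exists (G : finGroupType) (f : {multiplicative S -> G}),
    bijective f /\ solvable [set: G].

Definition subsemigroup_closed (S : finSemigroup) (A : {set S}) : bool :=
  [forall x in A, forall y in A, (x * y)%g \in A].

Definition subsemigroup_gen (S : finSemigroup) (Sigma : {set S}) : {set S} :=
  \bigcap_(A : {set S} | (Sigma \subset A) && subsemigroup_closed A) A.

(* Init k s is the instruction r_k <- s, and Mult k i j is r_k <- r_i * r_j. *)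
Variant instr (T : Type) :=
  | Init of nat & T
  | Mult of nat & nat & nat.
Arguments Mult {T} _ _ _.

Definition instr_regs (T : Type) (c : instr T) : seq nat :=
  match c with Init k _ => [:: k] | Mult k i j => [:: k; i; j] end.

Section StraightLinePrograms.
Variable S : finSemigroup.
Implicit Types (Sigma : {set S}) (p : seq (instr S)).

(* None marks an unassigned register. *)
Definition registers := nat -> option S.

Definition assign (r : registers) (k : nat) (x : S) : registers :=
  [eta r with k |-> Some x].

(* The result is None when the instruction is not allowed: it stores an element
   outside Sigma or reads an unassigned register. *)
Definition step Sigma (r : registers) (c : instr S) : option registers :=
  match c with
  | Init k s => if s \in Sigma then Some (assign r k s) else None
  | Mult k i j =>
      if (r i, r j) is (Some x, Some y) then Some (assign r k (x * y)%g)
      else None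
  end.

Definition run Sigma p : option registers :=
  foldl (fun r c => obind (fun r' => step Sigma r' c) r) (Some (fun=> None)) p.

Definition computes Sigma p (t : S) : Prop :=
  exists2 r, run Sigma p = Some r & exists k, r k = Some t.

Definition width p : nat := size (undup (flatten (map (@instr_regs S) p))).

End StraightLinePrograms.

(* Widths range over nat together with infinity, encoded as None. *)
Definition fits (w : option nat) (n : nat) : bool :=
  if w is Some m then n <= m else true.

(* For widths at least 2 the minima and maxima taken below are attained, by
   slp_costP and pv_complexityP; the default value 0 is reached only when no
   member of the class has at most N elements. *)
Definition min_nat (A : set nat) : nat := xget 0 (A `&` lbound A)%classic.
Definition max_nat (A : set nat) : nat := xget 0 (A `&` ubound A)%classic.

Definition slp_lengths (S : finSemigroup) (w : option nat) (t : S)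
    (Sigma : {set S}) : set nat :=
  [set n | exists p : seq (instr S),
     [/\ size p = n, fits w (width p) & computes Sigma p t]]%classic.

Definition slp_cost (S : finSemigroup) (w : option nat) (t : S)
    (Sigma : {set S}) : nat := min_nat (slp_lengths w t Sigma).

Definition sg_complexity (w : option nat) (S : finSemigroup) : nat :=
  \max_(Sigma : {set S}) \max_(t in subsemigroup_gen Sigma) slp_cost w t Sigma.

Definition pv_complexities (w : option nat) (H : finSemigroup -> Prop)
    (N : nat) : set nat :=
  [set m | exists S : finSemigroup,
     [/\ H S, #|{: S}| <= N & m = sg_complexity w S]]%classic.

Definition pv_complexity (w : option nat) (H : finSemigroup -> Prop) (N : nat)
  : nat := max_nat (pv_complexities w H N).

Lemma min_natP (A : set nat) :
  (exists n, A n) -> (A `&` lbound A)%classic (min_nat A).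
Proof.
move=> [n An]; apply: xgetPex.
have exA : exists n, `[< A n >] by exists n; apply/asboolP.
exists (ex_minn exA); case: ex_minnP => m /asboolP Am mP; split=> // k Ak.
by rewrite leEnat; apply: mP; apply/asboolP.
Qed.

Lemma max_natP (A : set nat) (b : nat) :
  (exists n, A n) -> (forall n, A n -> n <= b) ->
  (A `&` ubound A)%classic (max_nat A).
Proof.
move=> [n An] Ab; apply: xgetPex.
have exA : exists n, `[< A n >] by exists n; apply/asboolP.
have bA k : `[< A k >] -> k <= b by move/asboolP; apply: Ab.
exists (ex_maxn exA bA); case: ex_maxnP => m /asboolP Am mP; split=> // k Ak.
by rewrite leEnat; apply: mP; apply/asboolP.
Qed.

Section WellDefined.
Variables (S : finSemigroup) (Sigma : {set S}).

Lemma slp_run_rcons p c :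
  run Sigma (rcons p c) = obind (fun r => step Sigma r c) (run Sigma p).
Proof. by rewrite /run -cats1 foldl_cat. Qed.

Let grow (X : {set S}) : {set S} :=
  Sigma :|: [set (x * s)%g | x : S in X, s : S in Sigma].

Let grow_mono : {homo grow : X Y / X \subset Y}.
Proof. by move=> X Y XY; exact: finset.setUS (imset2Sl _ _ XY). Qed.

Lemma grow_slp n x : x \in iter n grow finset.set0 ->
  exists p, [/\ size p <= n.*2,
    {subset flatten (map (@instr_regs S) p) <= [:: 0; 1]}
    & exists2 r, run Sigma p = Some r & r 0 = Some x].
Proof.
elim: n x => [|n IH] x /=; first by rewrite inE.
rewrite inE => /orP[xS|/imset2P[y s /IH[p [sp rp [r pr r0]]] sS ->]].
  exists [:: Init 0 x]; split=> //.
  - by move=> k; rewrite !inE => ->.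
  - by rewrite /run /= xS; exists (assign (fun=> None) 0 x).
exists (rcons (rcons p (Init 1 s)) (Mult 0 0 1)); split.
- by rewrite !size_rcons doubleS !ltnS.
- move=> k; rewrite !map_rcons !flatten_rcons !mem_cat.
  case/orP=> [/orP[/rp //|]|]; rewrite !inE; first by move=> ->; rewrite orbT.
  by case/or3P=> -> //; rewrite orbT.
- rewrite !slp_run_rcons pr /= sS /= {1 2}/assign /= r0.
  by exists (assign (assign r 1 s) 0 (y * s)%g).
Qed.

Lemma gen_sub_grow : subsemigroup_gen Sigma \subset iter #|{: S}| grow finset.set0.
Proof.
have fixE : grow (fixset grow) = fixset grow := fixsetK grow_mono.
apply: finset.bigcap_inf; rewrite -[iter _ _ _]/(fixset grow).
have SF : Sigma \subset fixset grow by rewrite -fixE finset.subsetUl.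
have FS x s : x \in fixset grow -> s \in Sigma -> (x * s)%g \in fixset grow.
  by move=> xF sS; rewrite -fixE inE; apply/orP; right; apply: imset2_f.
rewrite SF; apply/forall_inP => x xF; apply/forall_inP => y.
rewrite {1}/fixset; elim: #|_| y => [|n IH] y /=; first by rewrite inE.
rewrite inE => /orP[/(FS x)->//|/imset2P[z s /IH xz sS ->]].
by rewrite mulgA FS.
Qed.

Lemma slp_exists w t : fits w 2 -> t \in subsemigroup_gen Sigma ->
  exists2 n, n <= #|{: S}|.*2 & slp_lengths w t Sigma n.
Proof.
move=> w2 /(fintype.subsetP gen_sub_grow)/grow_slp[p [sp rp [r pr r0]]].
exists (size p) => //; exists p; split=> //; last by exists r => //; exists 0.
have : width p <= 2.
  apply: (@uniq_leq_size _ _ [:: 0; 1]); first exact: undup_uniq.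
  by move=> k; rewrite mem_undup => /rp.
by case: w w2 => //= m m2 /leq_trans; apply.
Qed.

Lemma slp_costP w t : fits w 2 -> t \in subsemigroup_gen Sigma ->
  (slp_lengths w t Sigma `&` lbound (slp_lengths w t Sigma))%classic
    (slp_cost w t Sigma).
Proof.
by move=> w2 tS; apply: min_natP; have [n _ nP] := slp_exists w2 tS; exists n.
Qed.

End WellDefined.

Lemma sg_complexity_le w (S : finSemigroup) : fits w 2 -> sg_complexity w S <= #|{: S}|.*2.
Proof.
move=> w2; apply/bigmax_leqP => Sigma _; apply/bigmax_leqP => t tS.
have [n nle nP] := slp_exists w2 tS.
by apply: leq_trans nle; have [_ /(_ _ nP)] := slp_costP w2 tS.
Qed.

Lemma pv_complexityP w (H : finSemigroup -> Prop) N :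
  fits w 2 -> (exists2 S : finSemigroup, H S & #|{: S}| <= N) ->
  (pv_complexities w H N `&` ubound (pv_complexities w H N))%classic
    (pv_complexity w H N).
Proof.
move=> w2 [S HS SN]; apply: (@max_natP _ N.*2).
  by exists (sg_complexity w S), S.
move=> _ [T [_ TN ->]]; apply: leq_trans (sg_complexity_le _ w2) _.
by rewrite leq_double.
Qed.

(* Main.v *)
Require Import Defs.
From mathcomp Require Import all_boot all_order all_algebra all_fingroup.
From mathcomp Require Import all_solvable.
From mathcomp Require Import zify.

(** Both bounds hold uniformly for all finite solvable groups [G] and all
    generating sets [Sigma] of [G].  Their common core is
    [derived_sub_of_commutators].  Let [X] and [D] be normal in [G] with
    [X'' <= D], and let [T], a subset of [X], generate [X] modulo [X'].
    If [X'] is not contained in [D], then already some [[~ x, y]] or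
    [[~ x ^ s, y]] with [x, y] in [T] and [s] in [Sigma] lies outside [D].  One
    conjugation by a generator and one commutator thus suffice to get deeper
    into the group.  Otherwise, modulo [D], the group [K = <<T>>] would be
    abelian and commute with all its conjugates [K ^ s].  Since [X = K X'] with
    [X'] abelian, [[X', K] = X'], and for abelian [K] this forces
    [C_X'(K) = 1] ([commg_abelian_cent1]).  Then [C_X(K) = K], so that [K]
    contains its conjugates and is normal, [X' = [X', K] <= K], and
    [X' <= C_X'(K) = 1].

    Unboundedly many registers.  Descend the derived series and compute, for
    each [d], a list of elements of [G^(d)] that generate it modulo
    [G^(d+1)].  As long as the list for [d+1] does not generate, a conjugate of
    one of its elements, or a commutator of elements of the list for [d], can
    be added at a bounded cost, and each addition at least doubles the subgroup
    generated so far.  The total cost is therefore logarithmic.  Every element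
    of [G] is a product of powers of the listed elements with exponents below
    the relative orders, which costs another [O(log |G|)] by repeated squaring.
    Inverses are free up to a constant factor: the inverse of the product [p]
    of all letters used is a power of [p], and each inverse letter is a product
    of a suffix of [p] and of the inverse of a longer suffix
    ([slp_without_inverses]).

    Four registers.  One register holds the product built so far, three are for
    the current element.  For a normal subgroup [D < G], start from a generator
    outside [D] and replace [f], as long as its normal closure [X] is not
    abelian modulo [D], by a commutator outside [D] of two conjugates of [f] by
    words in [Sigma].  By the common core, words of length
    [log |X : X'| + 1] suffice, and the new closure lies in [X'], so the lengths
    of all the words used add up to [O(log |G|)].  Conjugation by a letter costs
    [O(log |G|)], hence the final [f] costs [O(log^2 |G|)].  Conjugates of
    this [f] by words of logarithmic length generate its closure modulo [D].
    Altogether [G] has a chain of subgroups with [O(log |G|)] steps, each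
    obtained by adjoining an element of cost [O(log^2 |G|)] that normalises the
    previous subgroup.

    Costs that have to add up to a logarithm are bounded in exponential form,
    such as [2 ^ cost * |Y| ^ c <= |X| ^ c]; these bounds multiply along chains
    of subgroups. *)

Set Implicit Arguments.
Unset Strict Implicit.
Unset Printing Implicit Defensive.
Import GroupScope.

(** * Binary length and cyclic extensions *)

Section Bits.
Variable gT : finGroupType.

Definition bits := (trunc_log 2 #|gT|).+1.

Lemma cardT_gt0 : (0 < #|gT|)%N.
Proof. by apply/card_gt0P; exists 1. Qed.

Lemma expg_cardT (x : gT) : x ^+ #|gT| = 1.
Proof. by rewrite -cardsT; apply/expg_cardG/in_setT. Qed.

Lemma trunc_log_bits e k :
  (e <= 2 ^ k * #|gT|)%N -> ((trunc_log 2 e).+1 <= bits + k)%N.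
Proof.
move=> le_e; rewrite /bits addSn ltnS.
apply: leq_trans (leq_trunc_log 2 le_e) _.
elim: k {le_e} => [|k IHk]; first by rewrite mul1n addn0.
rewrite expnS -mulnA mul2n trunc_log2_double ?addnS ?ltnS //.
by rewrite muln_gt0 expn_gt0 cardT_gt0.
Qed.

Lemma leq_bits k n : (2 ^ n <= #|gT| ^ k)%N -> (n <= k * bits)%N.
Proof.
move=> /leq_trans-/(_ (2 ^ (k * bits)))%N; rewrite leq_exp2l //; apply.
have [-> //|k_gt0] := posnP k; rewrite mulnC expnM leq_exp2r //.
by rewrite ltnW // trunc_log_ltn.
Qed.

End Bits.

Lemma proper_double_card (gT : finGroupType) (A B : {group gT}) :
  A \proper B -> (2 * #|A| <= #|B|)%N.
Proof.
move=> /[dup] /proper_sub sAB prAB; rewrite -(Lagrange sAB) mulnC leq_mul2l.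
by rewrite indexg_gt1 proper_subn ?orbT.
Qed.

(** The witness [m] is the order of [x] modulo [D]. *)
Lemma join_cycle_decomp (gT : finGroupType) (D : {group gT}) x :
  x \in 'N(D) -> x \notin D ->
  exists m : nat, [/\ (1 < m)%N, #|D <*> <[x]>| = (m * #|D|)%N &
    forall t, t \in D <*> <[x]> ->
      exists e d, [/\ e < m, d \in D & t = x ^+ e * d]].
Proof.
move=> nDx notDx; exists #[coset D x].
have nDX : <[x]> \subset 'N(D) by rewrite cycle_subG.
have DX : D <*> <[x]> = <[x]> * D.
  by rewrite joingC norm_joinEl.
have xpow t : t \in D <*> <[x]> ->
    exists e d, [/\ e < #[coset D x], d \in D & t = x ^+ e * d].
  rewrite DX => /mulsgP[_ d /cycleP[j ->] Dd ->].
  set e := j %% #[coset D x]; exists e, ((x ^+ e)^-1 * x ^+ j * d).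
  split; [by rewrite ltn_mod order_gt0 | | by rewrite -!mulgA mulKVg].
  rewrite groupM //; apply: coset_idr; first by rewrite groupM ?groupV ?groupX.
  rewrite morphM ?groupV ?groupX // morphV ?groupX // !morphX //.
  by rewrite expg_mod_order mulVg.
split=> //.
- by rewrite order_gt1; apply: contra notDx => /eqP/(coset_idr nDx).
- have <- : #|(D <*> <[x]>) / D| = #[coset D x].
    by rewrite quotientYidl // quotient_cycle.
  rewrite card_quotient ?join_subG ?normG // mulnC Lagrange //.
  exact: joing_subl.
Qed.

(** * Abelian supplements of derived subgroups *)

(** For [x] in [K] the map [y |-> [~ y, x]] is an endomorphism of [L] that
    commutes with the action of [K].  Its image [M] therefore inherits
    [[M, K] = M], and so does [L / M].  By induction [C_L(K)] is trivial in
    [L / M], hence contained in [M], where it is trivial by induction again.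
    The induction fails only if [M = 1], which is avoided by choosing [x]
    outside [C(L)], or if [M = L], and then the map is injective. *)
Lemma commg_abelian_cent1 n (gT : finGroupType) (K L : {group gT}) :
  #|L| < n -> abelian K -> abelian L -> K \subset 'N(L) -> [~: L, K] = L ->
  'C_L(K) = 1.
Proof.
elim: n gT K L => // n IHn gT K L ltLn abK abL nLK LK.
have [/exists_inP[x Kx ncLx]|/exists_inPn cLK] :=
  boolP [exists x in K, x \notin 'C(L)]; last first.
  have/commG1P LK1: K \subset 'C(L).
    by apply/subsetP=> x Kx; have:= cLK x Kx; rewrite negbK.
  by apply/trivgP; rewrite -LK1 commGC LK subsetIl.
have Lr y : y \in L -> [~ y, x] \in L.
  by move=> Ly; rewrite groupM ?groupV // memJ_norm // (subsetP nLK).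
have dM : {in L &, {morph (fun y => [~ y, x]) : y z / y * z}}.
  move=> y z Ly Lz /=; rewrite commMgJ conjgE.
  by rewrite (centsP abL _ (Lr y Ly) z Lz) mulKg.
pose d := Morphism dM; set M := (d @* L)%G.
have sML : M \subset L.
  by apply/subsetP=> _ /morphimP[y _ Ly ->]; apply: Lr.
have dK y k : y \in L -> k \in K -> d (y ^ k) = d y ^ k.
  move=> Ly Kk; rewrite /d /= conjRg [x ^ k]conjgE.
  by rewrite (centsP abK x Kx k Kk) mulKg.
have nMK : K \subset 'N(M).
  apply/subsetP=> k Kk; rewrite inE.
  apply/subsetP=> _ /imsetP[_ /morphimP[y _ Ly ->] ->].
  by rewrite -dK //; apply: mem_morphim; rewrite memJ_norm // (subsetP nLK).
have MK : [~: M, K] = M.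
  apply/eqP; rewrite eqEsubset commg_subl nMK /=.
  suff: d @* [~: L, K] \subset [~: M, K] by rewrite LK.
  rewrite morphim_gen; last by rewrite -gen_subG -/([~: L, K]) LK.
  rewrite gen_subG; apply/subsetP=> _ /morphimP[_ _ /imset2P[y k Ly Kk ->] ->].
  rewrite commgEl morphM ?groupV ?memJ_norm ?(subsetP nLK) // morphV // dK //.
  by rewrite -commgEl mem_commg // mem_morphim.
have [ML|nML] := eqVneq (M : {set gT}) L.
  have injd : 'injm d by rewrite -card_im_injm -[d @* L]/(M : {set gT}) ML.
  apply/trivgP/subsetP=> y /setIP[Ly cKy]; rewrite inE; apply/eqP.
  apply: (injmP injd) => //; rewrite morph1 /=; apply/eqP/commgP.
  exact: (centP cKy x Kx).
have ltML : #|M| < #|L| by rewrite proper_card // properEneq nML.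
have cM : 'C_M(K) = 1.
  by apply: IHn MK => //; [apply: leq_trans ltML _ | apply: abelianS abL].
have nML' : L \subset 'N(M) by rewrite cents_norm // (centSS _ sML abL).
have ntM : (M : {set gT}) != 1.
  apply: contra ncLx => /eqP M1; apply/centP=> y Ly; apply/commute_sym/commgP.
  by rewrite -in_set1 -[[set 1]]M1 (mem_morphim d Ly).
have cQ : 'C_(L / M)(K / M) = 1.
  apply: IHn; rewrite ?quotient_abelian ?quotient_norms //.
  - by apply: leq_trans (ltn_quotient ntM sML) _.
  - by rewrite /= -quotientR ?LK.
apply/trivgP; rewrite -cM subsetI subsetIr andbT.
rewrite -(quotient_sub1 (subset_trans (subsetIl _ _) nML')) -cQ.
by rewrite subsetI quotientS ?subsetIl // quotient_cents // subsetIr.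
Qed.

Section AbelianSupplement.
Variables (gT : finGroupType) (Sigma : {set gT}).

Lemma norm_gen_conj (U : {group gT}) :
  (forall x s, x \in U -> s \in Sigma -> x ^ s \in U) ->
  <<Sigma>> \subset 'N(U).
Proof.
move=> US; rewrite gen_subG; apply/subsetP=> s Ss; rewrite inE.
by apply/subsetP=> _ /imsetP[x Ux ->]; apply: US.
Qed.

(** The case [D = 1] of [derived_sub_of_commutators].  The hypothesis on the
    conjugates of [K] puts them into [C_X(K)], which is [K] itself because
    [C_X'(K)] is trivial. *)
Lemma abelian_supplement_derived (X K : {group gT}) :
  X <| <<Sigma>> -> abelian X^`(1) -> abelian K -> K * X^`(1) = X ->
  (forall s, s \in Sigma -> K :^ s \subset 'C(K)) -> X^`(1) = 1.
Proof.
move=> nsX abL abK KL cKs; set L := X^`(1) in abL KL *.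
have sKX : K \subset X by rewrite -KL mulG_subl.
have sLX : L \subset X := der_sub 1 X.
have nLX : X \subset 'N(L) := der_norm 1 X.
have nLK : K \subset 'N(L) := subset_trans sKX nLX.
have sLKL : [~: L, K] \subset L by rewrite commg_subl.
have nLKX : X \subset 'N([~: L, K]).
  rewrite -KL mul_subG ?commg_normr //.
  by apply: cents_norm; apply: centSS abL.
have LK : [~: L, K] = L.
  apply/eqP; rewrite eqEsubset sLKL /=.
  have nLKL := subset_trans sLX nLKX; have nLKK := subset_trans sKX nLKX.
  apply: der1_min => //; rewrite -{1}KL quotientMl // abelianM.
  by rewrite !quotient_abelian //= quotient_cents2.
have cLK : 'C_L(K) = 1 by apply: (@commg_abelian_cent1 #|L|.+1).
have KC : X :&: 'C(K) = K.
  have := group_modl L abK; rewrite KL setIC => <-.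
  by rewrite setIC cLK mulg1.
have nK : <<Sigma>> \subset 'N(K).
  apply: norm_gen_conj => x s Kx Ss; rewrite -KC inE.
  have Xx : x ^ s \in X.
    rewrite memJ_norm ?(subsetP sKX) //.
    by rewrite (subsetP (normal_norm nsX)) // mem_gen.
  by rewrite Xx (subsetP (cKs s Ss)) // memJ_conjg.
have sLK : L \subset K.
  rewrite -LK commg_subr (subset_trans sLX) // (subset_trans _ nK) //.
  exact: normal_sub.
by apply/trivgP; rewrite -cLK subsetI subxx /= (centSS sLK _ abK).
Qed.

End AbelianSupplement.

(** Both constructions use the contrapositive, with [D] the part of the group
    that is already available: a commutator that is new modulo [D] exists with
    at most one conjugation by a generator inside. *)
Lemma derived_sub_of_commutators (gT : finGroupType) (Sigma T : {set gT})
    (X D : {group gT}) :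
  X <| <<Sigma>> -> D <| <<Sigma>> -> X^`(2) \subset D -> T \subset X ->
  <<T>> * X^`(1) = X ->
  (forall x y, x \in T -> y \in T -> [~ x, y] \in D) ->
  (forall s x y, s \in Sigma -> x \in T -> y \in T -> [~ x ^ s, y] \in D) ->
  X^`(1) \subset D.
Proof.
move=> nsX nsD sX2 sTX TX cT cTs.
have nDG := normal_norm nsD.
have nDX : X \subset 'N(D) := subset_trans (normal_sub nsX) nDG.
have nDS : Sigma \subset 'N(D) := subset_trans (subset_gen _) nDG.
have nDT : T \subset 'N(D) := subset_trans sTX nDX.
have nDX1 : X^`(1) \subset 'N(D) := subset_trans (der_sub 1 X) nDX.
rewrite -quotient_sub1 // quotient_der //.
have T_gen : <<T>> / D = <<T / D>> by rewrite quotient_gen.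
rewrite (@abelian_supplement_derived _ (Sigma / D) (X / D) (<<T>> / D)) //.
- by rewrite -quotient_gen // quotient_normal.
- apply/derG1P; rewrite -[LHS]/((X / D)^`(2)) -quotient_der //.
  by apply/trivgP; rewrite quotient_sub1 // (subset_trans (der_sub 2 X)).
- rewrite /= T_gen abelian_gen.
  apply/centsP=> _ /morphimP[x nx Tx ->] _ /morphimP[y ny Ty ->].
  by apply/commgP; rewrite -morphR //= coset_id // cT.
- by rewrite -quotient_der // -quotientMl ?TX // gen_subG.
- move=> _ /morphimP[s ns Ss ->]; rewrite /= T_gen -genJ cent_gen gen_subG.
  apply/centsP=> _ /imsetP[_ /morphimP[x nx Tx ->] ->] _ /morphimP[y ny Ty ->].
  rewrite -morphJ //; apply/commgP; rewrite -morphR ?groupJ //.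
  by rewrite /= coset_id // cTs.
Qed.

(** * Logarithmic length with unboundedly many registers *)

Section StraightLine.
Variables (gT : finGroupType) (Sigma : {set gT}).
Implicit Types (l : seq gT) (inv : bool).

Local Notation bits := (bits gT).

(** A straight-line program that never overwrites a register is the list of the
    elements it computes, the latest first.  With [inv = true] the identity and
    inverses of earlier elements are admitted too; [slp_without_inverses]
    removes them at the end. *)
Definition slp_step inv l x : Prop :=
  [\/ x \in Sigma, exists y z, [/\ y \in l, z \in l & x = y * z]
    | inv /\ (x = 1 \/ x^-1 \in l)].

Fixpoint slp inv l : Prop :=
  if l is x :: l' then slp_step inv l' x /\ slp inv l' else True.

Lemma slp_gen inv l x : x \in Sigma -> slp inv l -> slp inv (x :: l).
Proof. by split=> //; constructor 1. Qed.

Lemma slp_mul inv l y z :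
  y \in l -> z \in l -> slp inv l -> slp inv (y * z :: l).
Proof. by split=> //; constructor 2; exists y, z. Qed.

Lemma slp_inv l y : y \in l -> slp true l -> slp true (y^-1 :: l).
Proof. by split=> //; constructor 3; split=> //; right; rewrite invgK. Qed.

Lemma slp_one l : slp true l -> slp true (1 :: l).
Proof. by split=> //; constructor 3; split=> //; left. Qed.

Lemma slp_pow inv l y e : slp inv l -> y \in l -> (0 < e)%N ->
  exists l', [/\ slp inv (l' ++ l), y ^+ e \in l' ++ l
                & (size l' <= 2 * trunc_log 2 e)%N].
Proof.
move=> lP ly; have [n] := ubnP e; elim: n e => // n IHn e len e_gt0.
have [e_le1|e_gt1] := leqP e 1%N.
  have -> : e = 1%N by apply/eqP; rewrite eqn_leq e_le1.
  by exists [::]; rewrite expg1.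
have h_gt0 : (0 < e./2)%N by rewrite half_gt0.
have [|l' [l'P l'y sl']] := IHn e./2 _ h_gt0.
  by rewrite -ltnS (leq_trans _ len) // ltnS -divn2 ltn_Pdiv.
have [] := (slp_mul l'y l'y l'P); set q := y ^+ e./2 in l'y *.
move=> q2P _; rewrite trunc_log2S // mulnS.
have qP : slp inv (q * q :: l' ++ l) by split.
have qE : q * q = y ^+ (e./2).*2 by rewrite -addnn expgD.
have := odd_double_half e; case: (odd e) => eE.
- exists (y * (q * q) :: q * q :: l'); split.
  + by apply: slp_mul qP; rewrite !inE ?mem_cat ?ly ?orbT ?eqxx.
  + by rewrite -{1}eE add1n expgS -qE mem_head.
  + by rewrite /= add2n !ltnS.
- exists (q * q :: l'); split=> //; first by rewrite -{1}eE add0n -qE mem_head.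
  by rewrite /= add2n; apply: leqW; rewrite ltnS.
Qed.

Fixpoint suffixes_in (u l : seq gT) : Prop :=
  if u is x :: u' then
    [/\ x \in l, \prod_(y <- u) y \in l & suffixes_in u' l]
  else 1 \in l.

Lemma suffixes_in_sub u l l' :
  {subset l <= l'} -> suffixes_in u l -> suffixes_in u l'.
Proof.
move=> ll'; elim: u => [|x u IHu] /=; first exact: ll'.
by case=> /ll' ? /ll' ? /IHu.
Qed.

Lemma suffixes_in_head u l : suffixes_in u l -> \prod_(y <- u) y \in l.
Proof. by case: u => [|x u] /=; [rewrite big_nil | case]. Qed.

Lemma slp_suffixes u l : {subset u <= Sigma} -> slp false l -> 1 \in l ->
  exists l', [/\ slp false (l' ++ l), suffixes_in u (l' ++ l)
               & (size l' <= 2 * size u)%N].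
Proof.
move=> + lP l1; elim: u => [|x u IHu] uS; first by exists [::].
have [y uy|l' [l'P us sl']] := IHu; first by apply: uS; rewrite inE uy orbT.
exists (x * \prod_(y <- u) y :: x :: l'); split.
- apply: slp_mul; rewrite ?mem_head ?inE ?(suffixes_in_head us) ?orbT //.
  by apply: slp_gen => //; apply/uS/mem_head.
- rewrite /= big_cons !inE !eqxx orbT; split=> //.
  by apply: suffixes_in_sub us => z; rewrite !inE => ->; rewrite !orbT.
- by rewrite /= mulnS add2n !ltnS.
Qed.

(** With [p] the product of the letters after [x] one has
    [x^-1 = p * (x * p)^-1] and [p^-1 = (x * p)^-1 * x].  The first identity
    gives the inverse of the first letter, the second one the inverse needed
    for the remaining letters. *)
Lemma slp_suffix_inverses u l : slp false l -> suffixes_in u l ->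
  (\prod_(y <- u) y)^-1 \in l ->
  exists l', [/\ slp false (l' ++ l), {in u, forall x, x^-1 \in l' ++ l}
               & (size l' <= 2 * size u)%N].
Proof.
elim: u l => [|x u IHu] l lP /=; first by exists [::].
case=> lx _ us; rewrite big_cons; set p := \prod_(y <- u) y => lxp.
have lp : p \in l := suffixes_in_head us.
have l1P : slp false (p * (x * p)^-1 :: l) by apply: slp_mul.
have l2P : slp false ((x * p)^-1 * x :: p * (x * p)^-1 :: l).
  by apply: slp_mul l1P; rewrite inE ?lx ?lxp orbT.
have p_inv : (x * p)^-1 * x = p^-1 by rewrite invMg mulgKV.
have x_inv : p * (x * p)^-1 = x^-1 by rewrite invMg mulKVg.
rewrite p_inv x_inv in l2P.
have [||l' [l'P l'u sl']] := IHu _ l2P.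
- by apply: suffixes_in_sub us => z lz; rewrite !inE lz !orbT.
- by rewrite mem_head.
exists (l' ++ [:: p^-1; x^-1]); split.
- by rewrite -catA.
- move=> y; rewrite -catA inE => /predU1P[->|/l'u //].
  by rewrite mem_cat !inE eqxx !orbT.
- by rewrite size_cat /= addn2 mulnS add2n !ltnS.
Qed.

(** Inverting every letter as a power of itself would cost a factor
    [log |G|]; only the product of all letters is inverted in this way. *)
Lemma slp_letter_inverses s0 u : s0 \in Sigma -> {subset u <= Sigma} ->
  exists l, [/\ slp false l, 1 \in l, {in u, forall x, x \in l /\ x^-1 \in l}
               & (size l <= 4 * size u + 4 * bits)%N].
Proof.
move=> S0 uS; have gT_gt0 := cardT_gt0 gT.
have s0P : slp false [:: s0] by apply: slp_gen.
have [l1 [l1P l1y sl1]] := slp_pow s0P (mem_head s0 [::]) gT_gt0.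
rewrite expg_cardT in l1y.
have [l2 [l2P us sl2]] := slp_suffixes uS l1P l1y.
set p := \prod_(y <- u) y; set l3 := _ ++ _ in l2P us.
(* The exponent [2 * #|gT| - 1] is positive even if the group is trivial. *)
have e_gt0 : (0 < (2 * #|gT|).-1)%N.
  by move: gT_gt0; case: #|gT| => // n _; rewrite mulnS.
have [l4 [l4P l4p sl4]] := slp_pow l2P (suffixes_in_head us) e_gt0.
have pE : p ^+ (2 * #|gT|).-1%N = p^-1.
  apply: (mulgI p); rewrite mulgV -expgS prednK ?muln_gt0 // mulnC expgM.
  by rewrite expg_cardT expg1n.
rewrite -/p pE in l4p.
have us4 : suffixes_in u (l4 ++ l3).
  by apply: suffixes_in_sub us => z lz; rewrite mem_cat lz orbT.
have [l5 [l5P l5u sl5]] := slp_suffix_inverses l4P us4 l4p.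
have u_in x : x \in u -> x \in l4 ++ l3.
  elim: (u) us4 => //= y u' IHu [ly _ /IHu{}IHu].
  by rewrite inE => /predU1P[->|/IHu].
exists (l5 ++ l4 ++ l3); split=> //.
- by rewrite catA mem_cat orbC [1 \in l3]mem_cat l1y orbT.
- move=> x ux; split; last exact: l5u.
  by rewrite mem_cat u_in ?orbT.
- have sl4' : (size l4 <= 2 * bits)%N.
    rewrite (leq_trans sl4) // leq_mul2l /= /bits -trunc_log2_double ?gT_gt0 //.
    by rewrite leq_trunc_log // -mul2n leq_pred.
  rewrite /l3 !size_cat /=; move: sl1 sl2 sl5 sl4'; rewrite /bits.
  move: (size l1) (size l2) (size l4) (size l5) (size u) (trunc_log _ _) => *.
  lia.
Qed.

Lemma slp_without_inverses s0 l : s0 \in Sigma -> slp true l ->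
  exists l', [/\ slp false l', {subset l <= l'}
               & (size l' <= 6 * size l + 4 * bits)%N].
Proof.
move=> S0 lP; pose u := [seq x <- l | x \in Sigma].
have uS : {subset u <= Sigma} by move=> x; rewrite mem_filter => /andP[].
have [b [bP b1 bu sb]] := slp_letter_inverses S0 uS.
suff [l' [l'P ll' sl']] : exists l', [/\ slp false (l' ++ b),
    {in l, forall x, x \in l' ++ b /\ x^-1 \in l' ++ b}
  & (size l' <= 2 * size l)%N].
  exists (l' ++ b); split=> //; first by move=> x /ll'[].
  have su : (size u <= size l)%N by rewrite size_filter count_size.
  rewrite size_cat; move: sb sl' su.
  by move: (size l) (size l') (size u) (size b) bits => *; lia.
have {bu}bu : {in l, forall x, x \in Sigma -> x \in b /\ x^-1 \in b}.
  by move=> x lx Sx; apply: bu; rewrite mem_filter Sx.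
(* The new list is closed under inversion, so each old step takes at most two
   products. *)
elim: l lP bu {u uS sb} => [|x l IHl] /= => [_ _|[xP lP] bu].
  by exists [::].
have [|l' [l'P ll' sl']] := IHl lP.
  by move=> y ly; apply: bu; rewrite inE ly orbT.
have mem_l' y a b' : y \in l' ++ b -> y \in [:: a, b' & l' ++ b].
  by move=> ly; rewrite !inE ly !orbT.
have inb y : y \in b -> y \in l' ++ b by move=> yb; rewrite mem_cat yb orbT.
suff [x_in|[a [a' [aP aE a'E]]]] : x \in l' ++ b /\ x^-1 \in l' ++ b \/
    exists a a', [/\ slp false [:: a, a' & l' ++ b], a = x & a' = x^-1].
- exists l'; split=> //; last by rewrite mulnS (leq_trans sl') // leq_addl.
  by move=> y; rewrite inE => /predU1P[->|/ll'].
- exists [:: a, a' & l']; split=> //; last by rewrite /= mulnS add2n !ltnS.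
  move=> y; rewrite inE => /predU1P[->|/ll'[? ?]]; last by split; apply: mem_l'.
  by rewrite aE a'E !inE !eqxx !orbT.
case: xP => [Sx|[y [z [/ll'[ly lyV] /ll'[lz lzV] ->]]]|[_ [->|/ll'[lxV]]]].
- by left; have [|/inb xb /inb] := bu x _ Sx; rewrite ?mem_head.
- right; exists (y * z), (z^-1 * y^-1); rewrite invMg; split=> //.
  by apply: slp_mul; rewrite ?inE ?ly ?lz ?orbT //; apply: slp_mul.
- by left; rewrite invg1; split; apply: inb.
- by rewrite invgK; left.
Qed.

Lemma slp_conj l x s : s \in Sigma -> x \in l -> slp true l ->
  exists l', [/\ slp true (l' ++ l), x ^ s \in l' ++ l & size l' = 4].
Proof.
move=> Ss lx lP; exists [:: s^-1 * x * s; s^-1 * x; s^-1; s].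
split=> //; last by rewrite conjgE mulgA mem_head.
apply: slp_mul; rewrite ?inE ?eqxx ?orbT //.
apply: slp_mul; rewrite ?inE ?eqxx ?lx ?orbT //.
by apply: slp_inv; rewrite ?mem_head //; apply: slp_gen.
Qed.

Lemma slp_comm l x y : x \in l -> y \in l -> slp true l ->
  exists l', [/\ slp true (l' ++ l), [~ x, y] \in l' ++ l & size l' = 5].
Proof.
move=> lx ly lP.
exists [:: x^-1 * y^-1 * (x * y); x * y; x^-1 * y^-1; y^-1; x^-1].
split=> //; last by rewrite commgEl conjgE !mulgA mem_head.
apply: slp_mul; rewrite ?inE ?eqxx ?orbT //.
apply: slp_mul; rewrite ?inE ?lx ?ly ?orbT //.
apply: slp_mul; rewrite ?inE ?eqxx ?orbT //.
by apply: slp_inv; rewrite ?inE ?ly ?orbT //; apply: slp_inv.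
Qed.

(** Modulo [Y], the list [l] makes multiplication by an element of [X] cheap.
    Carrying the factor [y] along saves the extra product otherwise needed to
    combine two consecutive layers.  The exponent 3 pays for the
    [2 * log e + 1] products that multiply by [x ^+ e], where [e] is less than
    the index [m >= 2]. *)
Definition reduces l (X Y : {group gT}) : Prop :=
  forall l1 y t, slp true l1 -> {subset l <= l1} -> y \in l1 -> t \in X ->
  exists l2 z, [/\ slp true (l2 ++ l1), z \in l2 ++ l1, z^-1 * (y * t) \in Y
    & (2 ^ size l2 * #|Y| ^ 3 <= #|X| ^ 3)%N].

Lemma reduces_refl l Y : reduces l Y Y.
Proof. by move=> l1 y t ? ? ? ?; exists [::], y; rewrite mulKg mul1n. Qed.

Lemma reduces_trans l X Y Z : reduces l X Y -> reduces l Y Z -> reduces l X Z.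
Proof.
move=> XY YZ l1 y t l1P ll1 ly Xt.
have [l2 [y2 [l2P ly2 Yt2 s2]]] := XY l1 y t l1P ll1 ly Xt.
have [|l3 [z [l3P l3z Zt s3]]] := YZ (l2 ++ l1) y2 _ l2P _ ly2 Yt2.
  by move=> x /ll1 lx; rewrite mem_cat lx orbT.
exists (l3 ++ l2), z; rewrite -catA; split=> //; first by rewrite mulKVg in Zt.
apply: leq_trans s2; rewrite size_cat expnD mulnAC mulnC leq_mul2l.
by rewrite mulnC mulnC s3 orbT.
Qed.

Lemma reduces_sub l l' X Y :
  {subset l <= l'} -> reduces l X Y -> reduces l' X Y.
Proof.
by move=> ll' XY l1 y t l1P l'l1; apply: XY => // x /ll'/l'l1.
Qed.

Lemma reduces_cycle l (Y : {group gT}) x :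
  x \in l -> x \in 'N(Y) -> x \notin Y -> reduces l (Y <*> <[x]>) Y.
Proof.
move=> lx nYx notYx l1 y t l1P ll1 ly /=.
have [m [m_gt1 cardX Xdec]] := join_cycle_decomp nYx notYx.
move=> /Xdec[e [d [lt_em Yd ->]]].
have [->|e_gt0] := posnP e.
  exists [::], y; split=> //; first by rewrite mul1g mulKg.
  by rewrite mul1n cardX leq_exp2r // leq_pmull // ltnW.
have [l2 [l2P l2x s2]] := slp_pow l1P (ll1 x lx) e_gt0.
exists (y * x ^+ e :: l2), (y * x ^+ e); split.
- by apply: slp_mul => //; rewrite mem_cat ly orbT.
- exact: mem_head.
- by rewrite [y * (_ * _)]mulgA mulKg.
rewrite /= cardX expnMn leq_mul2r; apply/orP; right.
have le_e : (2 ^ trunc_log 2 e <= m)%N.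
  by rewrite (leq_trans _ (ltnW lt_em)) // trunc_logP.
rewrite !expnS expn0 muln1 leq_mul //.
rewrite (leq_trans (leq_pexp2l _ s2)) // mulnC expnM.
by rewrite -mulnn leq_mul.
Qed.

Definition span (T : seq gT) (Y : {group gT}) : {group gT} :=
  (<<[set:: T]>> <*> Y)%G.

Lemma span_cons x T Y : span (x :: T) Y = (span T Y <*> <[x]>)%G.
Proof.
apply/val_inj; rewrite /= set_cons !joing_idl joing_idr setUC.
by rewrite /joing setUAC.
Qed.

Implicit Types (T : seq gT) (X Y : {group gT}).

Lemma sub_span T Y : Y \subset span T Y.
Proof. exact: joing_subr. Qed.

Lemma mem_span T Y x : x \in T -> x \in span T Y.
Proof. by move=> Tx; apply/(subsetP (joing_subl _ _))/mem_gen; rewrite inE. Qed.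

Lemma span_sub T X Y : {subset T <= X} -> Y \subset X -> span T Y \subset X.
Proof.
move=> TX YX; rewrite join_subG YX gen_subG andbT.
by apply/subsetP=> x; rewrite inE => /TX.
Qed.

(** As long as the elements collected do not generate [X] modulo [Y], one more
    can be computed by at most 10 instructions.  Since [X / Y] is abelian, it
    normalises the subgroup [span T Y] reached so far, which at least doubles;
    this pays for the instructions. *)
Lemma level_fill (X Y : {group gT}) l0 :
  Y \subset X -> X^`(1) \subset Y -> slp true l0 ->
  (forall l T, slp true l -> {subset l0 <= l} -> {subset T <= l} ->
     {subset T <= X} -> ~~ (X \subset span T Y) ->
     exists x l', [/\ slp true (l' ++ l), x \in l' ++ l, x \in X,
                      x \notin span T Y & (size l' <= 10)%N]) ->
  exists l T, [/\ slp true (l ++ l0), {subset T <= l ++ l0}, span T Y = X,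
    (2 ^ size l * #|Y| ^ 10 <= #|X| ^ 10)%N & reduces (l ++ l0) X Y].
Proof.
move=> sYX sX1Y l0P grow.
suff fill n l T : (#|X| - #|span T Y| < n)%N -> slp true (l ++ l0) ->
    {subset T <= l ++ l0} -> {subset T <= X} ->
    (2 ^ size l * #|Y| ^ 10 <= #|span T Y| ^ 10)%N ->
    reduces (l ++ l0) (span T Y) Y ->
  exists l T, [/\ slp true (l ++ l0), {subset T <= l ++ l0}, span T Y = X,
    (2 ^ size l * #|Y| ^ 10 <= #|X| ^ 10)%N & reduces (l ++ l0) X Y].
- have E0 : span [::] Y = Y.
    by apply/val_inj; rewrite /= set_nil gen0 joing1G.
  apply: (fill _ [::] [::]) => //; first by rewrite E0 mul1n.
  by rewrite E0; apply: reduces_refl.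
elim: n l T => // n IHn l T ltn lP Tl TX cost red.
have sDX := span_sub TX sYX.
have [sXD|nXD] := boolP (X \subset span T Y).
  have E : span T Y = X by apply/val_inj/eqP; rewrite eqEsubset sDX.
  by rewrite E in cost red; exists l, T.
have ll0 : {subset l0 <= l ++ l0} by move=> x; rewrite mem_cat orbC => ->.
have [x [l' [l'P l'x Xx Dx sl']]] := grow _ _ lP ll0 Tl TX nXD.
have nDx : x \in 'N(span T Y).
  have /normal_norm/subsetP-> // : span T Y <| X.
  by rewrite sub_der1_normal // (subset_trans sX1Y) ?sub_span.
have [m [m_gt1 cardD _]] := join_cycle_decomp nDx Dx.
have sub' : {subset l ++ l0 <= l' ++ l ++ l0}.
  by move=> y ly; rewrite mem_cat ly orbT.
have D_gt0 := cardG_gt0 (span T Y).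
have TX' : {subset x :: T <= X} by move=> y; rewrite inE => /predU1P[->|/TX].
apply: (IHn (l' ++ l) (x :: T)); rewrite -?catA //.
- have: (#|span (x :: T) Y| <= #|X|)%N by rewrite subset_leq_card ?span_sub.
  rewrite span_cons cardD => leX; rewrite -ltnS; apply: leq_trans ltn.
  rewrite ltnS ltn_sub2l //; last by rewrite ltn_Pmull.
  by apply: leq_trans leX; rewrite ltn_Pmull.
- by move=> y; rewrite inE => /predU1P[->|/Tl/sub'].
- rewrite span_cons cardD size_cat expnD expnMn -mulnA leq_mul //.
  by rewrite (leq_trans (leq_pexp2l _ sl')) // leq_exp2r.
- rewrite span_cons; apply: reduces_trans (reduces_sub sub' red).
  exact: reduces_cycle.
Qed.

(** Either [D = span T Y] is not normal, and a conjugate by a generator leaves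
    it, or [derived_sub_of_commutators] applies to [G^(d)] and [D] and provides
    a commutator outside [D]. *)
Lemma derived_level_step d l0 T0 l T :
  slp true l0 -> {subset T0 <= l0} ->
  span T0 (<<Sigma>>^`(d.+1))%G = (<<Sigma>>^`(d))%G ->
  slp true l -> {subset l0 <= l} -> {subset T <= l} ->
  {subset T <= <<Sigma>>^`(d.+1)} ->
  ~~ (<<Sigma>>^`(d.+1) \subset span T (<<Sigma>>^`(d.+2))%G) ->
  exists x l', [/\ slp true (l' ++ l), x \in l' ++ l, x \in <<Sigma>>^`(d.+1),
                   x \notin span T (<<Sigma>>^`(d.+2))%G & (size l' <= 10)%N].
Proof.
move=> l0P T0l0 T0E lP l0l Tl TX nXD; set Y := (_^`(d.+2))%G in nXD *.
set D := span T Y in nXD *.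
have T0l : {subset T0 <= l} by move=> x /T0l0/l0l.
have nsG k : <<Sigma>>^`(k) <| <<Sigma>> := der_normal k _.
have DX : D \subset <<Sigma>>^`(d.+1).
  by apply: (@span_sub T (<<Sigma>>^`(d.+1))%G) => //; apply: der_subS.
have XS k x s : x \in <<Sigma>>^`(k) -> s \in Sigma -> x ^ s \in <<Sigma>>^`(k).
  move=> Xx Ss; rewrite memJ_norm // (subsetP (normal_norm (nsG k))) //.
  exact: mem_gen.
have T0G : {subset T0 <= <<Sigma>>^`(d)}.
  move=> x Tx; have: x \in span T0 (<<Sigma>>^`(d.+1))%G := mem_span _ Tx.
  by rewrite T0E.
have T0com x y : x \in <<Sigma>>^`(d) -> y \in <<Sigma>>^`(d) ->
    [~ x, y] \in <<Sigma>>^`(d.+1).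
  by move=> Xx Xy; rewrite dergSn mem_commg.
have [|nconj] := boolP [exists x, [exists s in Sigma,
    (x \in T) && (x ^ s \notin D)]].
  case/existsP=> x /exists_inP[s Ss /andP[Tx Dxs]].
  have [l' [l'P l'x sl']] := slp_conj Ss (Tl x Tx) lP.
  by exists (x ^ s), l'; rewrite sl' XS ?TX.
have [|ncom] := boolP [exists x, [exists y,
    [&& x \in T0, y \in T0 & [~ x, y] \notin D]]].
  case/existsP=> x /existsP[y /and3P[Tx Ty Dxy]].
  have [l' [l'P l'x sl']] := slp_comm (T0l x Tx) (T0l y Ty) lP.
  by exists [~ x, y], l'; rewrite sl' T0com ?T0G.
have [|ncomJ] := boolP [exists s in Sigma, [exists x, [exists y,
    [&& x \in T0, y \in T0 & [~ x ^ s, y] \notin D]]]].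
  case/exists_inP=> s Ss /existsP[x /existsP[y /and3P[Tx Ty Dxy]]].
  have [l1 [l1P l1x sl1]] := slp_conj Ss (T0l x Tx) lP.
  have l1y : y \in l1 ++ l by rewrite mem_cat T0l ?orbT.
  have [l2 [l2P l2x sl2]] := slp_comm l1x l1y l1P.
  exists [~ x ^ s, y], (l2 ++ l1).
  by rewrite -catA size_cat sl1 sl2 T0com ?XS ?T0G.
case/negP: nXD.
apply: (@derived_sub_of_commutators _ Sigma [set:: T0] (<<Sigma>>^`(d))%G).
- exact: nsG.
- rewrite /normal (subset_trans DX (der_sub _ _)) norm_gen_conj // => x s Dx Ss.
  have: x ^ s \in D :^ s by rewrite memJ_conjg.
  have nYs : s \in 'N(Y) by rewrite (subsetP (normal_norm (nsG _))) // mem_gen.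
  rewrite /= conjYg (normP nYs) -genJ; apply/subsetP.
  rewrite join_subG sub_span andbT gen_subG.
  apply/subsetP=> _ /imsetP[y + ->]; rewrite inE => Ty.
  apply/negPn; apply: contra nconj => Dys.
  by apply/existsP; exists y; apply/exists_inP; exists s; rewrite // Ty.
- exact: sub_span.
- by apply/subsetP=> x; rewrite inE => /T0G.
- have /(congr1 val)/= := T0E; rewrite norm_joinEl // gen_subG.
  apply/subsetP=> x; rewrite inE => /T0G; apply/subsetP.
  exact: (der_norm 1 (<<Sigma>>^`(d))%G).
- move=> x y; rewrite !inE => Tx Ty; apply/negPn; apply: contra ncom => Dxy.
  by apply/existsP; exists x; apply/existsP; exists y; rewrite Tx Ty.
- move=> s x y Ss; rewrite !inE => Tx Ty; apply/negPn.
  apply: contra ncomJ => Dxy; apply/exists_inP; exists s => //.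
  by apply/existsP; exists x; apply/existsP; exists y; rewrite Tx Ty.
Qed.

Lemma derived_levels d : exists l T,
  [/\ slp true l, {subset T <= l},
      span T (<<Sigma>>^`(d.+1))%G = (<<Sigma>>^`(d))%G,
      (2 ^ size l * #|<<Sigma>>^`(d.+1)| ^ 10 <= #|<<Sigma>>| ^ 10)%N
    & reduces l <<Sigma>>%G (<<Sigma>>^`(d.+1))%G].
Proof.
elim: d => [|d [l0 [T0 [l0P T0l0 T0E cost red]]]].
  have grow0 l T : slp true l -> {subset [::] <= l} -> {subset T <= l} ->
    {subset T <= <<Sigma>>%G} ->
    ~~ (<<Sigma>>%G \subset span T (<<Sigma>>^`(1))%G) ->
    exists x l', [/\ slp true (l' ++ l), x \in l' ++ l, x \in <<Sigma>>%G,
      x \notin span T (<<Sigma>>^`(1))%G & (size l' <= 10)%N].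
    move=> lP _ _ _ nGD.
    have /subsetPn[s Ss Ds] : ~~ (Sigma \subset span T (<<Sigma>>^`(1))%G).
      by apply: contra nGD; rewrite gen_subG.
    exists s, [:: s]; rewrite mem_head mem_gen //; split=> //.
    exact: slp_gen.
  have [l [T []]] :=
    level_fill (der_sub 1 _) (subxx _) (I : slp true [::]) grow0.
  rewrite cats0 => lP Tl TE cost red; exists l, T; split=> //.
  by apply/val_inj; rewrite TE.
have [l [T [lP Tl TE cost1 red1]]] :=
  @level_fill (<<Sigma>>^`(d.+1))%G (<<Sigma>>^`(d.+2))%G l0 (der_subS _ _)
    (subxx _) l0P (fun l T => @derived_level_step d l0 T0 l T l0P T0l0 T0E).
have sub0 : {subset l0 <= l ++ l0} by move=> x lx; rewrite mem_cat lx orbT.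
exists (l ++ l0), T; split=> //.
- rewrite size_cat expnD -mulnA mulnCA (leq_trans _ cost) //.
  by rewrite leq_mul2l cost1 orbT.
- exact: reduces_trans (reduces_sub sub0 red) red1.
Qed.

Theorem slp_solvable t :
  solvable <<Sigma>> -> t \in <<Sigma>> -> Sigma != set0 ->
  exists l, [/\ slp false l, t \in l & (size l <= 100 * bits)%N].
Proof.
move=> solG Gt /set0Pn[s0 S0].
have [d triv] := derivedP _ solG.
have G1 : <<Sigma>>^`(d.+1) = 1 by rewrite dergSn triv comm1G.
have [l [T [lP _ _]]] := derived_levels d.
rewrite G1 cards1 !exp1n !muln1 => cost red.
have [|l2 [z [l2P l2z]]] := red (1 :: l) 1 t (slp_one lP) _ (mem_head _ _) Gt.
  by move=> x lx; rewrite inE lx orbT.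
rewrite /= G1 inE mul1g cards1 exp1n muln1 -eq_mulVg1 => /eqP zt cost2.
have [l3 [l3P l3l sl3]] := slp_without_inverses S0 l2P.
exists l3; split=> //; first by apply: l3l; rewrite -zt.
have bound k n : (2 ^ n <= #|<<Sigma>>| ^ k)%N -> (n <= k * bits)%N.
  move=> le_n; apply: leq_bits; apply: leq_trans le_n _.
  by case: k => // k; rewrite leq_exp2r // max_card.
move: (bound _ _ cost) (bound _ _ cost2) sl3; rewrite size_cat /=.
have: (0 < bits)%N by [].
by move: (size l) (size l2) (size l3) bits => *; lia.
Qed.

End StraightLine.

(** * Cubic logarithmic length with four registers *)

(** The cost of one generator of a layer, with [a = bits]: 1 for the initial
    letter, [10 * a * m] for the commutators leading to an abelian normal
    closure, [5 * a * i] for a conjugation by a word of length [i], and [2 * a]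
    for multiplying by a power of the result. *)
Lemma layer_cost a m i : (0 < a)%N -> (m <= 4 * a)%N -> (i <= a)%N ->
  (1 + 10 * a * m + 5 * a * i + 2 * a <= 50 * a ^ 2)%N.
Proof.
move=> a_gt0 le_m le_i.
have := leq_mul (leqnn (10 * a)) le_m; have := leq_mul (leqnn (5 * a)) le_i.
by have := leq_mul a_gt0 (leqnn a); rewrite -mulnn; nia.
Qed.

Lemma total_cost a k : (0 < a)%N -> (k <= a)%N ->
  (2 * a + 50 * a ^ 2 * k <= 52 * a ^ 3)%N.
Proof.
move=> a_gt0 le_k; have := leq_mul (leqnn (50 * a ^ 2)) le_k.
have := leq_mul (leq_mul a_gt0 a_gt0) (leqnn a).
by rewrite -mulnA !expnS !expn0 !muln1; nia.
Qed.

Section FourRegisters.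
Variables (gT : finGroupType) (Sigma : {set gT}).
Implicit Types (st : nat -> gT) (D U X : {group gT}).

Local Notation bits := (bits gT).

Let gT_gt0 : (0 < #|gT|)%N := cardT_gt0 gT.

Definition upd st k x : nat -> gT := fun i => if i == k then x else st i.

(** Executions of programs on registers 0 to 3.  All registers have a value in
    every state, which spares the bookkeeping of unassigned registers; four
    loads produce such a state. *)
Inductive exec : nat -> (nat -> gT) -> (nat -> gT) -> Prop :=
  | exec_nil st : exec 0 st st
  | exec_load n st st' k s : (k < 4)%N -> s \in Sigma ->
      exec n st st' -> exec n.+1 st (upd st' k s)
  | exec_mul n st st' k i j : (k < 4)%N -> (i < 4)%N -> (j < 4)%N ->
      exec n st st' -> exec n.+1 st (upd st' k (st' i * st' j)).

Definition runs c st st' : Prop := exists2 n, (n <= c)%N & exec n st st'.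

Lemma runs_refl st : runs 0 st st.
Proof. by exists 0%N => //; constructor. Qed.

Lemma runs_leq c c' st st' : (c <= c')%N -> runs c st st' -> runs c' st st'.
Proof. by move=> le_c [n nc ?]; exists n => //; apply: leq_trans le_c. Qed.

Lemma runs_trans c c' st st1 st2 :
  runs c st st1 -> runs c' st1 st2 -> runs (c + c') st st2.
Proof.
case=> m mc st_1 [n nc st1_2]; exists (m + n)%N; first exact: leq_add.
elim: st1_2 st_1 => [st'|q st' st'' k s k4 Ss _ IH
  |q st' st'' k i j k4 i4 j4 _ IH] st_1.
- by rewrite addn0.
- by rewrite addnS; apply: exec_load => //; apply: IH.
- by rewrite addnS; apply: exec_mul => //; apply: IH.
Qed.

Lemma runs_load k s st : (k < 4)%N -> s \in Sigma -> runs 1 st (upd st k s).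
Proof.
by move=> k4 Ss; exists 1%N => //; apply: exec_load => //; constructor.
Qed.

Lemma runs_mul k i j st : (k < 4)%N -> (i < 4)%N -> (j < 4)%N ->
  runs 1 st (upd st k (st i * st j)).
Proof.
by move=> k4 i4 j4; exists 1%N => //; apply: exec_mul => //; constructor.
Qed.

Lemma upd_eq st k x : upd st k x k = x.
Proof. by rewrite /upd eqxx. Qed.

Lemma upd_neq st k x i : i != k -> upd st k x i = st i.
Proof. by rewrite /upd => /negbTE->. Qed.

(** Reading the exponent from the leading bit uses no register besides source
    and target.  The restriction [1 < e] reflects that no instruction copies a
    register: the first step is a squaring. *)
Lemma runs_pow i j e st : (i < 4)%N -> (j < 4)%N -> i != j -> (1 < e)%N ->
  exists st', [/\ runs (2 * trunc_log 2 e) st st', st' j = st i ^+ e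
                & forall k, k != j -> st' k = st k].
Proof.
move=> i4 j4 ij; have [n] := ubnP e; elim: n e => // n IHn e len e_gt1.
suff [st1 [st1P st1j st1k]] : exists st1,
    [/\ runs (2 * (trunc_log 2 e./2)).+1 st st1, st1 j = st i ^+ (e./2).*2
      & forall k, k != j -> st1 k = st k].
  rewrite trunc_log2S // mulnS.
  have := odd_double_half e; case: (odd e) => eE; last first.
    exists st1; rewrite -{2}eE; split=> //; exact: runs_leq st1P.
  exists (upd st1 j (st1 j * st1 i)); split.
  - by have := runs_trans st1P (runs_mul st1 j4 j4 i4); rewrite addn1.
  - by rewrite upd_eq st1j st1k // -expgSr -{2}eE.
  - by move=> k kj; rewrite upd_neq // st1k.
have [e_lt4|e_ge4] := ltnP e 4.
  have -> : e./2 = 1%N by move: e e_gt1 e_lt4 {len} => [|[|[|[|e]]]].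
  exists (upd st j (st i * st i)); split.
  - by apply: runs_leq (runs_mul st j4 i4 i4).
  - by rewrite upd_eq.
  - by move=> k; apply: upd_neq.
have [||st1 [st1P st1j st1k]] := IHn e./2.
- by rewrite -ltnS (leq_trans _ len) // ltnS -divn2 ltn_Pdiv // ltnW.
- by rewrite -[2%N]/(4./2) half_leq.
exists (upd st1 j (st1 j * st1 j)); split.
- by have := runs_trans st1P (runs_mul st1 j4 j4 j4); rewrite addn1.
- by rewrite upd_eq st1j -expgD addnn.
- by move=> k kj; rewrite upd_neq // st1k.
Qed.

(** Reading the exponent from the last bit destroys the base in register [t]
    but multiplies the power directly onto register [j]. *)
Lemma runs_mull_pow j t e st : (j < 4)%N -> (t < 4)%N -> j != t ->
  exists st', [/\ runs (2 * (trunc_log 2 e).+1) st st', st' j = st t ^+ e * st j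
                & forall k, k != j -> k != t -> st' k = st k].
Proof.
move=> j4 t4 jt; have tj : t != j by rewrite eq_sym.
have [n] := ubnP e; elim: n e st => // n IHn e st len.
have [->|e_gt0] := posnP e.
  by exists st; rewrite mul1g; split=> //; apply: runs_leq (runs_refl st).
pose st1 := if odd e then upd st j (st t * st j) else st.
have st1P : runs 1 st st1.
  rewrite /st1; case: (odd e); first exact: runs_mul.
  exact: runs_leq (runs_refl st).
have st1j : st1 j = st t ^+ odd e * st j.
  by rewrite /st1; case: (odd e); rewrite ?upd_eq ?mul1g.
have st1k k : k != j -> st1 k = st k.
  by rewrite /st1; case: (odd e) => // kj; rewrite upd_neq.
pose st2 := upd st1 t (st1 t * st1 t).
have st2P : runs 2 st st2 := runs_trans st1P (runs_mul st1 t4 t4 t4).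
have st2j : st2 j = st t ^+ odd e * st j by rewrite /st2 upd_neq.
have st2t : st2 t = st t ^+ 2 by rewrite /st2 upd_eq st1k.
have st2k k : k != j -> k != t -> st2 k = st k.
  by move=> kj kt; rewrite /st2 upd_neq // st1k.
have [e_le1|e_gt1] := leqP e 1%N.
  have e1 : e = 1%N by apply/eqP; rewrite eqn_leq e_le1.
  by exists st2; rewrite st2j e1; split.
have [|st3 [st3P st3j st3k]] := IHn e./2 st2.
  by rewrite -ltnS (leq_trans _ len) // ltnS -divn2 ltn_Pdiv.
exists st3; split.
- by rewrite trunc_log2S // mulnS; apply: runs_trans st2P st3P.
- rewrite st3j st2t st2j mulgA -expgM -expgD mul2n addnC.
  by rewrite odd_double_half.
- by move=> k kj kt; rewrite st3k // st2k.
Qed.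

Lemma runs_copy i j st : (i < 4)%N -> (j < 4)%N -> i != j ->
  exists st', [/\ runs (2 * bits) st st', st' j = st i
                & forall k, k != j -> st' k = st k].
Proof.
move=> i4 j4 ij.
have [//|st' [st'P st'j st'k]] := @runs_pow i j #|gT|.+1 st i4 j4 ij _.
exists st'; split=> //; last by rewrite st'j expgS expg_cardT mulg1.
apply: runs_leq st'P; rewrite leq_mul2l /= -ltnS -[bits.+1]addn1.
by apply: trunc_log_bits; rewrite expn1 mul2n -addnn -addn1 leq_add2l.
Qed.

Lemma runs_inv i j st : (i < 4)%N -> (j < 4)%N -> i != j ->
  exists st', [/\ runs (4 * bits) st st', st' j = (st i)^-1
                & forall k, k != j -> st' k = st k].
Proof.
move=> i4 j4 ij.
(* The factor 3 makes the exponent exceed 1 even if the group is trivial. *)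
have e_gt1 : (1 < (3 * #|gT|).-1)%N by move: gT_gt0; lia.
have [st' [st'P st'j st'k]] := runs_pow st i4 j4 ij e_gt1.
exists st'; split=> //; last first.
  rewrite st'j; apply: (mulgI (st i)); rewrite mulgV -expgS prednK.
    by rewrite mulnC expgM expg_cardT expg1n.
  by rewrite muln_gt0.
apply: runs_leq st'P.
have /trunc_log_bits : ((3 * #|gT|).-1 <= 2 ^ 2 * #|gT|)%N by lia.
by rewrite /bits; lia.
Qed.

(** The factor [s^-1] on the left is [s] to the power [#|gT| - 1]; it
    destroys the copy of [s] in register [t], which is loaded again for the
    factor on the right. *)
Lemma runs_conj j t s st : (j < 4)%N -> (t < 4)%N -> j != t -> s \in Sigma ->
  exists st', [/\ runs (5 * bits) st st', st' j = st j ^ s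
                & forall k, k != j -> k != t -> st' k = st k].
Proof.
move=> j4 t4 jt Ss; pose st1 := upd st t s.
have [st2 [st2P st2j st2k]] := runs_mull_pow #|gT|.-1 st1 j4 t4 jt.
pose st3 := upd st2 t s; exists (upd st3 j (st3 j * st3 t)); split.
- have := runs_trans (runs_load st t4 Ss) (runs_trans st2P
    (runs_trans (runs_load st2 t4 Ss) (runs_mul st3 j4 j4 t4))).
  apply: runs_leq; have /trunc_log_bits : (#|gT|.-1 <= 2 ^ 0 * #|gT|)%N by lia.
  by rewrite /bits; lia.
- rewrite upd_eq /st3 upd_eq upd_neq // st2j /st1 upd_eq upd_neq //.
  rewrite conjgE mulgA.
  congr (_ * _ * _); apply: (mulgI s).
  by rewrite -expgS prednK // expg_cardT mulgV.
- by move=> k kj kt; rewrite upd_neq // /st3 upd_neq // st2k // /st1 upd_neq.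
Qed.

(** Register 1 receives [f] and registers 2 and 3 are scratch, while register 0
    keeps the product computed so far. *)
Definition computable c f : Prop :=
  forall st, exists st', [/\ runs c st st', st' 1%N = f & st' 0%N = st 0%N].

Lemma computable_leq c c' f : (c <= c')%N -> computable c f -> computable c' f.
Proof.
move=> le_c fP st; have [st' [? ? ?]] := fP st.
by exists st'; split=> //; apply: runs_leq le_c _.
Qed.

Lemma computable_gen s : s \in Sigma -> computable 1 s.
Proof.
by move=> Ss st; exists (upd st 1%N s); split=> //; apply: runs_load.
Qed.

(** Conjugates of [f] by words of length at most [i] in [Sigma]. *)
Fixpoint conjs f i : {set gT} :=
  if i is i'.+1 then conjs f i' :|: [set x ^ s | x in conjs f i', s in Sigma]
  else [set f].

Lemma conjs_mono f i x : x \in conjs f i -> x \in conjs f i.+1.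
Proof. by move=> fx; rewrite inE fx. Qed.

Lemma conjs_id f i : f \in conjs f i.
Proof. by elim: i => [|i]; [apply: set11 | apply: conjs_mono]. Qed.

Lemma conjs_conj f i x s :
  x \in conjs f i -> s \in Sigma -> x ^ s \in conjs f i.+1.
Proof. by move=> fx Ss; rewrite inE; apply/orP; right; apply: imset2_f. Qed.

Lemma conjs_class f i : conjs f i \subset f ^: <<Sigma>>.
Proof.
elim: i => [|i /subsetP IHi]; first by rewrite sub1set class_refl.
apply/subsetP=> x /setUP[/IHi //|/imset2P[y s /IHi fy Ss ->]].
by rewrite memJ_norm ?(subsetP (class_norm _ _)) // mem_gen.
Qed.

Lemma runs_conjs f i x j t st : (j < 4)%N -> (t < 4)%N -> j != t ->
  x \in conjs f i -> st j = f ->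
  exists st', [/\ runs (5 * bits * i) st st', st' j = x
                & forall k, k != j -> k != t -> st' k = st k].
Proof.
move=> j4 t4 jt; elim: i x => [|i IHi] x.
  by rewrite inE muln0 => /eqP-> stj; exists st; split=> //; apply: runs_refl.
rewrite mulnS; case/setUP=> [/IHi fx /fx[st' [st'P st'j st'k]]|].
  by exists st'; split=> //; apply: runs_leq st'P; apply: leq_addl.
case/imset2P=> y s /IHi fy Ss -> /fy[st1 [st1P <- st1k]].
have [st2 [st2P st2j st2k]] := runs_conj st1 j4 t4 jt Ss.
exists st2; split=> //; first by rewrite addnC; apply: runs_trans st1P st2P.
by move=> k kj kt; rewrite st2k ?st1k.
Qed.

Lemma computable_conjs c f i x :
  computable c f -> x \in conjs f i -> computable (c + 5 * bits * i) x.
Proof.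
move=> fP fx st; have [st1 [st1P st1f st10]] := fP st.
have [st2 [st2P st2x st2k]] := @runs_conjs f i x 1%N 3 st1 isT isT isT fx st1f.
by exists st2; rewrite (st2k 0%N) //; split=> //; apply: runs_trans st1P st2P.
Qed.

(** Three registers suffice: [f] is computed once and copied, both copies are
    conjugated in place with the third register as scratch, and [[~ x, y]] is
    obtained as [(y * x)^-1 * (x * y)], with a single inversion. *)
Lemma computable_commutator c f i x y : computable c f ->
  x \in conjs f i -> y \in conjs f i ->
  computable (c + 10 * bits * i.+1) [~ x, y].
Proof.
move=> fP fx fy st; have [st1 [st1P st1f st10]] := fP st.
have [st2 [st2P st22 st2k]] := @runs_copy 1%N 2 st1 isT isT isT.
rewrite st1f in st22.
have [st3 [st3P st3x st3k]] := @runs_conjs f i x 2 3 st2 isT isT isT fx st22.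
have st31 : st3 1%N = f by rewrite st3k // st2k.
have [st4 [st4P st4y st4k]] := @runs_conjs f i y 1%N 3 st3 isT isT isT fy st31.
have st42 : st4 2%N = x by rewrite st4k.
pose st5 := upd st4 3 (st4 2%N * st4 1%N).
pose st6 := upd st5 1%N (st5 1%N * st5 2%N).
have [st7 [st7P st72 st7k]] := @runs_inv 1%N 2 st6 isT isT isT.
exists (upd st7 1%N (st7 2%N * st7 3%N)); split.
- have := runs_trans st1P (runs_trans st2P (runs_trans st3P (runs_trans st4P
    (runs_trans (@runs_mul 3 2 1%N st4 isT isT isT)
    (runs_trans (@runs_mul 1%N 1%N 2 st5 isT isT isT)
    (runs_trans st7P (@runs_mul 1%N 2 3 st7 isT isT isT))))))).
  apply: runs_leq; have: (0 < bits)%N by [].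
  by move: bits => *; nia.
- rewrite upd_eq st72 st7k // /st6 upd_eq upd_neq // /st5 upd_eq !upd_neq //.
  by rewrite st42 st4y invMg commgEl conjgE !mulgA.
- by rewrite upd_neq // st7k // /st6 /st5 !upd_neq // st4k // st3k // st2k.
Qed.

(** The subgroups generated modulo [D] by [conjs f i] at least double with [i]
    until two consecutive ones agree; that one is normalised by [Sigma]. *)
Lemma conjs_normalised f (D : {group gT}) : <<Sigma>> \subset 'N(D) ->
  exists i, (2 ^ i * #|D| <= #|<<conjs f i>> <*> D|)%N /\
    <<Sigma>> \subset 'N(<<conjs f i>> <*> D).
Proof.
move=> nD; pose U i := (<<conjs f i>> <*> D)%G.
have nU i : U i.+1 \subset U i -> <<Sigma>> \subset 'N(U i).
  move=> sU; apply: norm_gen_conj => x s Ux Ss.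
  have: x ^ s \in (U i) :^ s by rewrite memJ_conjg.
  apply/subsetP; rewrite /= conjYg -genJ (normP (subsetP nD s (mem_gen Ss))).
  rewrite join_subG joing_subr andbT gen_subG.
  apply/subsetP=> _ /imsetP[y fy ->]; apply: (subsetP sU).
  by apply/(subsetP (joing_subl _ _))/mem_gen/conjs_conj.
have sUS i : U i \subset U i.+1.
  rewrite /= genS // setSU // genS //; apply/subsetP=> x; exact: conjs_mono.
suff grow n :
    (exists i, (2 ^ i * #|D| <= #|U i|)%N /\ <<Sigma>> \subset 'N(U i)) \/
    (2 ^ n * #|D| <= #|U n|)%N.
  have [//|] := grow #|gT|; rewrite leqNgt => /negP[].
  apply: leq_ltn_trans (max_card _) _.
  by apply: leq_trans (ltn_expl _ (ltnSn 1)) _; rewrite leq_pmulr.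
elim: n => [|n [|IHn]]; [| by left |].
  by right; rewrite mul1n subset_leq_card ?joing_subr.
have [/nU|] := boolP (U n.+1 \subset U n); first by left; exists n.
move=> nsU; right; rewrite expnS -mulnA.
apply: leq_trans (proper_double_card (A := U n) _).
  by rewrite leq_mul2l IHn.
by rewrite properE sUS.
Qed.

Definition normal_closure f : {group gT} := <<f ^: <<Sigma>> >>%G.

Lemma normal_closure_id f : f \in normal_closure f.
Proof. by rewrite mem_gen // class_refl. Qed.

Lemma normal_closure_normal f :
  f \in <<Sigma>> -> normal_closure f <| <<Sigma>>.
Proof.
move=> Gf; rewrite /normal norms_gen ?class_norm // gen_subG andbT.
by rewrite class_subG.
Qed.

Lemma normal_closure_sub f (U : {group gT}) :
  f \in U -> <<Sigma>> \subset 'N(U) -> normal_closure f \subset U.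
Proof. by move=> Uf nU; rewrite gen_subG class_sub_norm. Qed.

Lemma conjs_normal_closure f i : conjs f i \subset normal_closure f.
Proof. exact: subset_trans (conjs_class f i) (subset_gen _). Qed.

(** Modulo [D] the hypothesis says that [X'] equals its derived subgroup, and a
    solvable group with this property is trivial. *)
Lemma derived_in_self_mod (X D : {group gT}) : solvable X -> X \subset 'N(D) ->
  X^`(1) \subset X^`(2) <*> D -> X^`(1) \subset D.
Proof.
move=> solX nDX sX1; have nDX1 := subset_trans (der_sub 1 X) nDX.
rewrite -quotient_sub1 //; apply/trivgP/eqP; apply: contraT => ntQ.
have solQ : solvable (X / D) by apply: quotient_sol.
have sQ : X^`(1) / D \subset X / D by rewrite quotientS ?der_sub.
have := sol_der1_proper solQ sQ ntQ; rewrite properE => /andP[_ /negP[]].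
have nDX2 := subset_trans (der_sub 2 X) nDX.
rewrite -quotient_der // -[_^`(1)^`(1)]/(X^`(2)) -(quotientYidr nDX2).
exact: quotientS.
Qed.

(** The conjugates of [f] by words of length [i], where
    [2 ^ i <= |X : X'|], generate the normal closure [X] modulo [X'].  Were all
    commutators of conjugates by words of length [i + 1] in [D], they would be
    in [X'' D], and [derived_sub_of_commutators] would give [X' <= X'' D],
    whence [X' <= D]. *)
Lemma commutator_escape f (D : {group gT}) : solvable <<Sigma>> ->
  D <| <<Sigma>> -> f \in <<Sigma>> -> ~~ ((normal_closure f)^`(1) \subset D) ->
  exists i x y, [/\ x \in conjs f i.+1, y \in conjs f i.+1,
    [~ x, y] \notin D
  & (2 ^ i * #|(normal_closure f)^`(1)| <= #|normal_closure f|)%N].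
Proof.
move=> solG nsD Gf; set X := normal_closure f => nXD.
have nsX : X <| <<Sigma>> := normal_closure_normal Gf.
have [sXG nXG] := andP nsX; have [sDG nDG] := andP nsD.
have nsX' k : X^`(k) <| <<Sigma>> := gFnormal_trans _ nsX.
have [i [cardU nU]] := @conjs_normalised f X^`(1)%G (normal_norm (nsX' 1%N)).
have UE : <<conjs f i>> <*> X^`(1) = X.
  apply/eqP.
  rewrite eqEsubset join_subG gen_subG conjs_normal_closure der_sub /=.
  apply: (@normal_closure_sub f (<<conjs f i>> <*> X^`(1))%G) => //.
  by apply/(subsetP (joing_subl _ _))/mem_gen/conjs_id.
rewrite UE in cardU.
pose D2 := (X^`(2) <*> D)%G.
have sDD2 : D \subset D2 := joing_subr _ _.
suff [x [y [fx fy D2xy]]] : exists x y,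
    [/\ x \in conjs f i.+1, y \in conjs f i.+1 & [~ x, y] \notin D2].
  by exists i, x, y; split=> //; apply: contra D2xy; apply/subsetP.
have [|ncom] := boolP [exists x, [exists y,
    [&& x \in conjs f i.+1, y \in conjs f i.+1 & [~ x, y] \notin D2]]].
  by case/existsP=> x /existsP[y /and3P[]]; exists x, y.
have comD2 x y : x \in conjs f i.+1 -> y \in conjs f i.+1 -> [~ x, y] \in D2.
  move=> fx fy; apply/negPn; apply: contra ncom => Dxy.
  by apply/existsP; exists x; apply/existsP; exists y; rewrite fx fy.
case/negP: nXD.
apply: derived_in_self_mod (solvableS sXG solG) (subset_trans sXG nDG) _.
apply: (@derived_sub_of_commutators _ Sigma (conjs f i) X D2) => //.
- by rewrite /D2 /= normalY.
- exact: joing_subl.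
- exact: conjs_normal_closure.
- rewrite -norm_joinEl // gen_subG.
  by rewrite (subset_trans (conjs_normal_closure f i)) ?der_norm.
- by move=> x y fx fy; apply: comD2; apply: conjs_mono.
- move=> s x y Ss fx fy.
  by apply: comD2; [apply: conjs_conj | apply: conjs_mono].
Qed.

(** Iterate [commutator_escape].  A commutator costs [10 * bits * i.+2],
    charged to the index [|X : X'|], which is at least 2 and at least [2 ^ i],
    so that its fourth power exceeds [2 ^ i.+2].  The
    indices multiply to at most the order of the first closure because the next
    closure lies in [X']. *)
Lemma abelian_normal_closure c f (D : {group gT}) : solvable <<Sigma>> ->
  D <| <<Sigma>> -> f \in <<Sigma>> -> f \notin D -> computable c f ->
  exists f' m, [/\ f' \in <<Sigma>>, f' \notin D,
    (normal_closure f')^`(1) \subset D,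
    (2 ^ m <= #|normal_closure f| ^ 4)%N & computable (c + 10 * bits * m) f'].
Proof.
move=> solG nsD; have [n] := ubnP #|normal_closure f|.
elim: n f c => // n IHn f c ltn Gf Df fP.
have [sX1|nX1] := boolP ((normal_closure f)^`(1) \subset D).
  by exists f, 0%N; rewrite muln0 addn0 expn_gt0 cardG_gt0.
have [i [x [y [fx fy Dxy cardX]]]] := commutator_escape solG nsD Gf nX1.
have [sXG nXG] := andP (normal_closure_normal Gf).
have X1xy : [~ x, y] \in (normal_closure f)^`(1).
  by rewrite mem_commg // (subsetP (conjs_normal_closure f i.+1)).
have Gxy : [~ x, y] \in <<Sigma>>.
  by apply: subsetP X1xy; apply: subset_trans (der_sub _ _) sXG.
have sX1 : normal_closure [~ x, y] \subset (normal_closure f)^`(1).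
  apply: (@normal_closure_sub _ (normal_closure f)^`(1)%G) => //.
  exact: gFnorm_trans.
have prX : (normal_closure f)^`(1) \proper normal_closure f.
  apply: (sol_der1_proper solG) => //; apply: contra nX1 => /eqP X1.
  by rewrite (subset_trans (der_sub 1 _)) // X1 sub1G.
have ltX := leq_ltn_trans (subset_leq_card sX1) (proper_card prX).
have [f' [m [Gf' Df' f'1 cardm f'P]]] :=
  IHn _ _ (leq_trans ltX ltn) Gxy Dxy (computable_commutator fP fx fy).
exists f', (i.+2 + m)%N; split=> //; last first.
  by apply: computable_leq f'P; rewrite mulnDr addnA.
have le_m : (2 ^ m <= #|(normal_closure f)^`(1)| ^ 4)%N.
  by rewrite (leq_trans cardm) // leq_exp2r // subset_leq_card.
have := proper_double_card (A := (normal_closure f)^`(1)%G) prX.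
move: le_m cardX; rewrite expnD (expnD 2 2).
move: (2 ^ i)%N (2 ^ m)%N #|_^`(1)| #|normal_closure f|.
move=> a b p q le_b le_a le_2.
have le_p : (p <= q)%N by apply: leq_trans le_2; rewrite leq_pmull.
apply: (@leq_trans ((a * p) * ((2 * p) * ((2 * p) * p)))); last first.
  by rewrite !expnS expn0 muln1 !leq_mul.
apply: (@leq_trans (2 ^ 2 * a * p ^ 4)); first by rewrite leq_mul.
rewrite !expnS !expn0 !muln1.
by rewrite (AC (2*1*(1*(1*(1*1)))) ((3*4)*((1*5)*(2*6*7))))%AC.
Qed.

(** Multiplying on the left lets [runs_mull_pow] act directly on register 0. *)
Definition mult_computable c U : Prop := forall t st, t \in U ->
  exists2 st', runs c st st' & st' 0%N = t * st 0%N.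

Local Notation K := (50 * bits ^ 2)%N.

Definition covered U : Prop :=
  exists2 k, (2 ^ k <= #|U|)%N & mult_computable (K * k) U.

Lemma covered_cycle U x c : covered U -> x \in 'N(U) -> x \notin U ->
  computable c x -> (c + 2 * bits <= K)%N -> covered (U <*> <[x]>)%G.
Proof.
move=> [k le_k UP] nUx Ux xP le_c.
have [m [m_gt1 cardU Udec]] := join_cycle_decomp nUx Ux.
exists k.+1; first by rewrite /= cardU expnS leq_mul.
move=> t st /Udec[e [d [lt_em Ud ->]]].
have [st1 st1P st10] := UP d st Ud.
have [st2 [st2P st2x st20]] := xP st1.
have [st3 [st3P st3t _]] := @runs_mull_pow 0 1%N e st2 isT isT isT.
exists st3; last by rewrite st3t st2x st20 st10 mulgA.
have le_e : (e <= 2 ^ 0 * #|gT|)%N.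
  rewrite mul1n (leq_trans (ltnW lt_em)) //.
  rewrite (leq_trans _ (max_card (U <*> <[x]>))) // cardU leq_pmulr //.
have /trunc_log_bits := le_e; rewrite addn0 => le_te.
apply: runs_leq (runs_trans st1P (runs_trans st2P st3P)).
rewrite (mulnS K k) [leqRHS]addnC leq_add2l (leq_trans _ le_c) //.
by rewrite leq_add2l leq_mul2l.
Qed.

Lemma covered_seq (U X : {group gT}) (xs : seq gT) c :
  U \subset X -> X^`(1) \subset U -> {subset xs <= X} ->
  {in xs, forall x, computable c x} -> (c + 2 * bits <= K)%N -> covered U ->
  exists W : {group gT},
    [/\ covered W, U \subset W, W \subset X & {subset xs <= W}].
Proof.
move=> sUX sX1; elim: xs => [|x xs IHxs] Xxs xsP le_c UP; first by exists U.
have [||W [WP sUW sWX xsW]] := IHxs _ _ le_c UP.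
- by move=> y ys; apply: Xxs; rewrite inE ys orbT.
- by move=> y ys; apply: xsP; rewrite inE ys orbT.
have [Wx|Wx] := boolP (x \in W).
  by exists W; split=> // y; rewrite inE => /predU1P[->|/xsW].
have Xx : x \in X by rewrite Xxs ?mem_head.
have nWx : x \in 'N(W).
  have /normal_norm/subsetP-> // : W <| X.
  by rewrite sub_der1_normal // (subset_trans sX1).
have sWW : W \subset W <*> <[x]> := joing_subl _ _.
exists (W <*> <[x]>)%G; split.
- by apply: covered_cycle le_c => //; apply/xsP/mem_head.
- exact: subset_trans sUW sWW.
- by rewrite join_subG sWX cycle_subG.
- move=> y; rewrite inE => /predU1P[->|/xsW/(subsetP sWW)//].
  by rewrite (subsetP (joing_subr _ _)) ?cycle_id.
Qed.

(** The new layer is the normal closure of an element provided by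
    [abelian_normal_closure]; as it is abelian modulo [D], its generators can be
    adjoined one at a time in any order. *)
Lemma covered_layer (D : {group gT}) : solvable <<Sigma>> -> D <| <<Sigma>> ->
  ~~ (<<Sigma>> \subset D) -> covered D ->
  exists D1 : {group gT}, [/\ D1 <| <<Sigma>>, D \proper D1 & covered D1].
Proof.
move=> solG nsD nGD DP; have [sDG nDG] := andP nsD.
have /subsetPn[s Ss Ds] : ~~ (Sigma \subset D) by rewrite -gen_subG.
have Gs : s \in <<Sigma>> by rewrite mem_gen.
have [f [m [Gf Df f1 le_m fP]]] :=
  abelian_normal_closure solG nsD Gs Ds (computable_gen Ss).
have {le_m}le_m : (m <= 4 * bits)%N.
  by apply: leq_bits; apply: leq_trans le_m _; rewrite leq_exp2r // max_card.
have [sXG nXG] := andP (normal_closure_normal Gf).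
have [i [cardU nU]] := @conjs_normalised f D nDG.
have le_i : (i <= bits)%N.
  rewrite -[bits]mul1n; apply: leq_bits; rewrite expn1.
  apply: leq_trans (max_card _).
  by apply: leq_trans cardU; rewrite leq_pmulr.
pose X := (normal_closure f <*> D)%G.
have nDX : X \subset 'N(D) by rewrite join_subG normG (subset_trans sXG).
have sX1 : X^`(1) \subset D.
  rewrite der1_min // quotientYidr ?(subset_trans sXG) // sub_der1_abelian //.
have xsX : {subset enum (conjs f i) <= X}.
  move=> x; rewrite mem_enum => fx; apply/(subsetP (joing_subl _ _)).
  exact: (subsetP (conjs_normal_closure f i)).
have xsP : {in enum (conjs f i),
    forall x, computable (1 + 10 * bits * m + 5 * bits * i) x}.
  by move=> x; rewrite mem_enum; apply: computable_conjs.
have le_c : (1 + 10 * bits * m + 5 * bits * i + 2 * bits <= K)%N.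
  exact: layer_cost.
have [W [WP sDW sWX xsW]] := covered_seq (joing_subr _ _) sX1 xsX xsP le_c DP.
have WX : W = X.
  apply/val_inj/eqP; rewrite eqEsubset sWX join_subG sDW andbT.
  have sUW : <<conjs f i>> <*> D \subset W.
    rewrite join_subG sDW gen_subG andbT; apply/subsetP=> x fx.
    by apply: xsW; rewrite mem_enum.
  apply: subset_trans sUW.
  apply: (@normal_closure_sub f (<<conjs f i>> <*> D)%G) => //.
  by apply/(subsetP (joing_subl _ _))/mem_gen/conjs_id.
exists X; rewrite -{3}WX; split=> //.
  by rewrite normalY // normal_closure_normal.
rewrite properE joing_subr; apply: contra Df => /subsetP; apply.
by rewrite (subsetP (joing_subl _ _)) // normal_closure_id.
Qed.

Lemma covered_solvable : solvable <<Sigma>> -> covered <<Sigma>>%G.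
Proof.
move=> solG.
suff climb n (D : {group gT}) : (#|<<Sigma>>| - #|D| < n)%N -> D <| <<Sigma>> ->
    covered D -> covered <<Sigma>>%G.
  apply: (climb _ 1%G (ltnSn _)); first exact: normal1.
  exists 0%N; first by rewrite cards1.
  by move=> t st /set1P->; exists st; rewrite ?mul1g // muln0; apply: runs_refl.
elim: n D => // n IHn D ltn nsD DP.
have [sGD|nGD] := boolP (<<Sigma>> \subset D).
  suff <- : D = <<Sigma>>%G by [].
  by apply/val_inj/eqP; rewrite eqEsubset sGD normal_sub.
have [D1 [nsD1 prD D1P]] := covered_layer solG nsD nGD DP.
apply: IHn D1P => //; rewrite -ltnS; apply: leq_trans ltn; rewrite ltnS.
have ltD := proper_card prD; apply: ltn_sub2l => //.
exact: leq_trans ltD (subset_leq_card (normal_sub nsD1)).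
Qed.

Theorem runs_solvable s0 t :
  solvable <<Sigma>> -> s0 \in Sigma -> t \in <<Sigma>> ->
  exists2 st, runs (52 * bits ^ 3) (fun=> s0) st & st 0%N = t.
Proof.
move=> solG Ss0 Gt; have [k le_k GP] := covered_solvable solG.
have {le_k}le_k : (k <= bits)%N.
  rewrite -[bits]mul1n; apply: leq_bits; rewrite expn1.
  exact: leq_trans le_k (max_card _).
have e_gt1 : (1 < 2 * #|gT|)%N by move: gT_gt0; lia.
have [st1 [st1P st10 _]] := @runs_pow 1%N 0 _ (fun=> s0) isT isT isT e_gt1.
have [st2 st2P st20] := GP t st1 Gt.
exists st2; last by rewrite st20 st10 mulnC expgM expg_cardT expg1n mulg1.
apply: runs_leq (runs_trans st1P st2P).
rewrite (mul2n #|gT|) trunc_log2_double //; exact: total_cost.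
Qed.

End FourRegisters.

(** * From groups to semigroups isomorphic to groups *)

Section Transfer.
Variables (S : finSemigroup) (gT : finGroupType).
Variable phi : {multiplicative S -> gT}.
Variables (psi : gT -> S) (phiK : cancel phi psi) (psiK : cancel psi phi).
Variable Sigma : {set S}.

Let psiM x y : psi (x * y) = psi x * psi y.
Proof. by apply: (can_inj phiK); rewrite psiK gmulfM !psiK. Qed.

Let psi_gen x : x \in phi @: Sigma -> psi x \in Sigma.
Proof. by case/imsetP=> s Ss ->; rewrite phiK. Qed.

Lemma mem_subsemigroup_gen t :
  t \in subsemigroup_gen Sigma -> phi t \in <<phi @: Sigma>>.
Proof.
move/bigcapP/(_ [set x | phi x \in <<phi @: Sigma>>]); rewrite inE; apply.
apply/andP; split; first by apply/subsetP=> s Ss; rewrite inE mem_gen ?imset_f.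
apply/forall_inP=> x; rewrite inE => Gx; apply/forall_inP=> y.
by rewrite !inE gmulfM => Gy; apply: groupM.
Qed.

Lemma subsemigroup_gen_neq0 t :
  t \in subsemigroup_gen Sigma -> exists s, s \in Sigma.
Proof.
move/bigcapP/(_ Sigma) => tS; case: (pickP [in Sigma]) => [s Ss|S0].
  by exists s.
exists t; apply: tS; rewrite subxx.
by apply/forall_inP=> x; have:= S0 x; rewrite /= => ->.
Qed.

Lemma slp_program l : slp (phi @: Sigma) false l ->
  exists p r, [/\ size p = size l, run Sigma p = Some r
    & forall x, x \in l -> exists2 k, (k < size l)%N & r k = Some (psi x)].
Proof.
elim: l => [|x l IHl] /=; first by exists [::], (fun=> None).
case=> xP /IHl[p [r [sp rP rl]]].
suff [c cP] : exists c, step Sigma r c = Some (assign r (size l) (psi x)).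
  exists (rcons p c), (assign r (size l) (psi x)); split.
  - by rewrite size_rcons sp.
  - by rewrite slp_run_rcons rP.
  - move=> y; rewrite inE => /predU1P[->|/rl[k lk rk]].
      by exists (size l); rewrite // /assign /= eqxx.
    by exists k; rewrite ?ltnS ?(ltnW lk) // /assign /= ltn_eqF.
case: xP => [Sx|[y [z [/rl[i _ ri] /rl[j _ rj] ->]]]|[//]].
- by exists (Init (size l) (psi x)); rewrite /= psi_gen.
- by exists (Mult (size l) i j); rewrite /= ri rj psiM.
Qed.

Lemma exec_program n st st' p r : exec (phi @: Sigma) n st st' ->
  run Sigma p = Some r -> (forall k, (k < 4)%N -> r k = Some (psi (st k))) ->
  all (fun k => (k < 4)%N) (flatten (map (@instr_regs S) p)) ->
  exists p' r', [/\ size p' = (size p + n)%N, run Sigma p' = Some r',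
    forall k, (k < 4)%N -> r' k = Some (psi (st' k))
    & all (fun k => (k < 4)%N) (flatten (map (@instr_regs S) p'))].
Proof.
move=> stP rP; elim: stP => {n st st'} [st|n st st' k s k4 Ss _ IH
  |n st st' k i j k4 i4 j4 _ IH] rst pR.
- by exists p, r; rewrite addn0.
- have [p' [r' [sp' r'P r'st p'R]]] := IH rst pR.
  exists (rcons p' (Init k (psi s))), (assign r' k (psi s)); split.
  + by rewrite size_rcons sp' addnS.
  + by rewrite slp_run_rcons r'P /= psi_gen.
  + by move=> h h4; rewrite /assign /= /upd; case: eqP => // _; apply: r'st.
  + by rewrite map_rcons flatten_rcons all_cat p'R /= k4.
- have [p' [r' [sp' r'P r'st p'R]]] := IH rst pR.
  exists (rcons p' (Mult k i j)), (assign r' k (psi (st' i * st' j))); split.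
  + by rewrite size_rcons sp' addnS.
  + by rewrite slp_run_rcons r'P /= !r'st // psiM.
  + by move=> h h4; rewrite /assign /= /upd; case: eqP => // _; apply: r'st.
  + by rewrite map_rcons flatten_rcons all_cat p'R /= k4 i4 j4.
Qed.

Lemma slp_cost_le w t n :
  slp_lengths w t Sigma n -> (slp_cost w t Sigma <= n)%N.
Proof. by move=> nP; have [_ /(_ _ nP)] := min_natP (ex_intro _ n nP). Qed.

Lemma slp_cost_unbounded t :
  solvable [set: gT] -> t \in subsemigroup_gen Sigma ->
  (slp_cost None t Sigma <= 100 * bits gT)%N.
Proof.
move=> solT tS; have [s Ss] := subsemigroup_gen_neq0 tS.
have ntS : phi @: Sigma != set0 by apply/set0Pn; exists (phi s); apply: imset_f.
have solG := solvableS (subsetT _) solT.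
have [l [lP lt sl]] := slp_solvable (solG _) (mem_subsemigroup_gen tS) ntS.
have [p [r [sp rP rl]]] := slp_program lP.
apply: leq_trans sl; apply: slp_cost_le; exists p; split=> //.
by exists r => //; have [k _ rk] := rl _ lt; exists k; rewrite rk phiK.
Qed.

Lemma slp_cost_width4 t :
  solvable [set: gT] -> t \in subsemigroup_gen Sigma ->
  (slp_cost (Some 4) t Sigma <= 56 * bits gT ^ 3)%N.
Proof.
move=> solT tS; have [s Ss] := subsemigroup_gen_neq0 tS.
have SGs : phi s \in phi @: Sigma by apply: imset_f.
have solG := solvableS (subsetT _) solT.
have [st [n len stP] stt] :=
  runs_solvable (solG _) SGs (mem_subsemigroup_gen tS).
pose p0 := [:: Init 0 s; Init 1%N s; Init 2 s; Init 3 s].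
have [r0 r0P r0s] : exists2 r0, run Sigma p0 = Some r0 &
    forall k, (k < 4)%N -> r0 k = Some (psi (phi s)).
  rewrite /run /= !Ss /=; eexists; first by []. 
  by case=> [|[|[|[|k]]]] //= _; rewrite phiK.
have [p [r [sp rP rst pR]]] := exec_program stP r0P r0s isT.
apply: (@leq_trans (size p)).
  apply: slp_cost_le; exists p; split=> //; last first.
    by exists r => //; exists 0%N; rewrite rst // stt phiK.
  apply: (@uniq_leq_size _ _ (iota 0 4)); first exact: undup_uniq.
  by move=> k; rewrite mem_undup mem_iota => /(allP pR).
rewrite sp /= (leq_trans (leq_add (leqnn 4) len)) //.
have : (0 < bits gT ^ 3)%N by rewrite expn_gt0.
by move: (_ ^ 3)%N => *; lia.
Qed.

End Transfer.

(** For [1 < N] one has [bits gT <= 2 * trunc_log 2 N], which absorbs the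
    additive constants: [200 = 100 * 2] and [448 = 56 * 2 ^ 3]. *)
Lemma sg_complexity_solvable (S : finSemigroup) N : is_solvable_group S ->
  (#|{: S}| <= N)%N -> (1 < N)%N ->
  (sg_complexity None S <= 200 * trunc_log 2 N)%N /\
  (sg_complexity (Some 4) S <= 448 * trunc_log 2 N ^ 3)%N.
Proof.
move=> [gT [phi [[psi phiK psiK] solT]]] leN N_gt1.
have le_lam : (bits gT <= 2 * trunc_log 2 N)%N.
  have lN : (0 < trunc_log 2 N)%N by rewrite trunc_log_gt0.
  rewrite mul2n -addnn -addn1 /bits -addn1 leq_add // leq_trunc_log //.
  by rewrite -(bij_eq_card (Bijective phiK psiK)).
split; apply/bigmax_leqP=> Sigma _; apply/bigmax_leqP=> t tS.
- apply: leq_trans (slp_cost_unbounded phiK psiK solT tS) _.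
  by rewrite -[200]/(100 * 2)%N -mulnA leq_mul2l.
- apply: leq_trans (slp_cost_width4 phiK psiK solT tS) _.
  by rewrite -[448]/(56 * 2 ^ 3)%N -mulnA -expnMn leq_mul2l leq_exp2r.
Qed.

(** * Asymptotics *)

From mathcomp Require Import all_classical all_reals all_analysis.
Import Order.TTheory GRing.Theory Num.Theory.
Import numFieldNormedType.Exports.

Local Open Scope classical_set_scope.
Local Open Scope ring_scope.

Lemma max_nat_le (A : set nat) b :
  (forall m, A m -> (m <= b)%N) -> (max_nat A <= b)%N.
Proof. by move=> Ab; rewrite /max_nat; case: xgetP => // m -> [/Ab]. Qed.

Lemma pv_complexity_le w (H : finSemigroup -> Prop) N b :
  (forall S, H S -> (#|{: S}| <= N)%N -> (sg_complexity w S <= b)%N) ->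
  (pv_complexity w H N <= b)%N.
Proof. by move=> Hb; apply: max_nat_le => _ [S [HS SN ->]]; apply: Hb. Qed.

Lemma trunc_log_le_ln (R : realType) N : (1 < N)%N ->
  (trunc_log 2 N)%:R * ln 2 <= ln N%:R :> R.
Proof.
move=> N_gt1; have N_gt0 : (0 < N)%N by apply: ltnW.
rewrite mulrC mulr_natr -lnXn // ler_ln ?posrE ?exprn_gt0 ?ltr0n //.
by rewrite -natrX ler_nat trunc_logP.
Qed.

Lemma pv_complexity_bigO (R : realType) w (H : finSemigroup -> Prop)
    (C k : nat) :
  (forall S N, H S -> (#|{: S}| <= N)%N -> (1 < N)%N ->
     (sg_complexity w S <= C * trunc_log 2 N ^ k)%N) ->
  (fun N : nat => (pv_complexity w H N)%:R : R)
    =O_\oo (fun N : nat => ln (N%:R : R) ^+ k).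
Proof.
move=> HC; apply/eqO_exP; have ln2 : 0 < ln 2 :> R by rewrite ln_gt0 // ltr1n.
(* The successor of [C] keeps the constant positive when [C] is 0. *)
exists (C.+1%:R / ln 2 ^+ k); first by rewrite divr_gt0 ?exprn_gt0 ?ltr0n.
exists 2%N => // N /= N_gt1.
have lnN : 0 <= ln (N%:R : R) by rewrite ltW // ln_gt0 // ltr1n.
rewrite ger0_norm ?ler0n // ger0_norm ?exprn_ge0 //.
apply: (@le_trans _ _ (C.+1%:R * (trunc_log 2 N)%:R ^+ k)).
  rewrite -natrX -natrM ler_nat.
  apply: (@leq_trans (C * trunc_log 2 N ^ k)%N); last first.
    by rewrite leq_mul2r leqnSn orbT.
  by apply: pv_complexity_le => S HS SN; apply: HC.
rewrite -mulrA ler_wpM2l // mulrC -exprVn -exprMn.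
rewrite lerXn2r ?nnegrE ?ler0n ?(divr_ge0 lnN (ltW ln2)) //.
by rewrite ler_pdivlMr // trunc_log_le_ln.
Qed.

Theorem theorem21 (R : realType) (H : finSemigroup -> Prop)
    (pvH : pseudovariety H)
    (solvH : forall S : finSemigroup, H S -> is_solvable_group S) :
  (fun N : nat => (pv_complexity None H N)%:R : R)
    =O_\oo (fun N : nat => ln (N%:R : R)) /\
  (fun N : nat => (pv_complexity (Some 4%N) H N)%:R : R)
    =O_\oo (fun N : nat => ln (N%:R : R) ^+ 3).
Proof.
have bound S N (HS : H S) := @sg_complexity_solvable S N (solvH S HS).
split; last first.
  apply: (@pv_complexity_bigO R _ H 448 3) => S N HS SN N_gt1.
  by have [] := bound S N HS SN N_gt1.
have -> : (fun N : nat => ln (N%:R : R)) = (fun N => ln (N%:R : R) ^+ 1).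
  by apply/funext => N; rewrite expr1.
apply: (@pv_complexity_bigO R _ H 200 1) => S N HS SN N_gt1.
by have [] := bound S N HS SN N_gt1.
Qed.
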